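(* Let $v\in\mathbb{C}$. For real $n>0$ with $\mathrm{Re}(n+v)>-1$ define \[ \theta_n(v)=1+n\int_0^1 e^{n(1-z)}z^{n+v}\,dz-\frac{e^n}{2n^{n+v}}\Gamma(n+v+1). \] Then for every integer $R\geq1$, as $n\to\infty$, \[ \theta_n(v)=\rho_0(v)+\frac{\rho_1(v)}{n}+\cdots+\frac{\rho_{R-1}(v)}{n^{R-1}}+O\!\left(\frac{1}{n^R}\right), \] with an implied constant depending only on $R$ and $v$, where \[ \rho_r(v)=\delta_{r,0}-\sum_{m=0}^{2r+1}(-1)^m\binom{v}{2r+1-m}\sum_{k=0}^{m}\frac{(2r+2k)!!}{(-1)^k\,k!}\,\mathcal{A}_{m,k}\!\left(\tfrac13,\tfrac14,\tfrac15,\dots\right). \]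
   Context: For integers $n$ and $k\geq 0$ and a sequence $a_1,a_2,\dots$, the De Moivre polynomial $\mathcal{A}_{n,k}(a_1,a_2,\dots)$ is the coefficient of $x^n$ in $(a_1x+a_2x^2+a_3x^3+\cdots)^k$ (so $\mathcal{A}_{0,0}=1$, $\mathcal{A}_{n,k}=0$ for $n<k$). The double factorial: $n!!=n(n-2)\cdots$ down to $1$ or $2$ for $n\geq1$, with $0!!=(-1)!!=1$. $\binom{v}{j}=v(v-1)\cdots(v-j+1)/j!$ for complex $v$, and $\delta_{r,0}$ is the Kronecker delta. $n^{n+v}=e^{(n+v)\log n}$. For integers $n\geq1$ and $v$ with $n+v\geq 0$, $\theta_n(v)$ coincides with the number defined by $\sum_{j=0}^{n+v-1}\frac{n^j}{j!}+\frac{n^{n+v}}{(n+v)!}\theta_n(v)=\frac{e^n}{2}$. *)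

(* Defs.v *)
From Stdlib Require Import Reals.
From Coquelicot Require Export Coquelicot.
Export Coquelicot.Complex.
Open Scope R_scope.

Notation Cx := Coquelicot.Complex.C.

Definition cexp (w : Cx) : Cx :=
  (exp (Re w) * cos (Im w), exp (Re w) * sin (Im w)).

(* x^w = e^{w log x} for real x > 0 (principal branch); set to 0 for x <= 0
   (only used on sets of measure zero / endpoints). *)
Definition rcpow (x : R) (w : Cx) : Cx :=
  if Rlt_dec 0 x then cexp (Cmult w (RtoC (ln x))) else RtoC 0.

Definition CGamma (s : Cx) : Cx :=
  RInt_gen (V := C_R_CompleteNormedModule)
    (fun t => Cmult (rcpow t (Cminus s (RtoC 1))) (RtoC (exp (- t))))
    (at_right 0) (Rbar_locally p_infty).

Definition theta (n : R) (v : Cx) : Cx :=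
  Cplus (RtoC 1)
  (Cminus
    (Cmult (RtoC n)
      (RInt_gen (V := C_R_CompleteNormedModule)
         (fun z => Cmult (RtoC (exp (n * (1 - z)))) (rcpow z (Cplus (RtoC n) v)))
         (at_right 0) (at_point 1)))
    (Cdiv (Cmult (RtoC (exp n)) (CGamma (Cplus (Cplus (RtoC n) v) (RtoC 1))))
          (Cmult (RtoC 2) (rcpow n (Cplus (RtoC n) v))))).

Fixpoint dfact (n : nat) : nat :=
  match n with
  | O => 1%nat
  | S O => 1%nat
  | S ((S m) as p) => (S p * dfact m)%nat
  end.

Fixpoint falling (v : Cx) (j : nat) : Cx :=
  match j with
  | O => RtoC 1
  | S i => Cmult (falling v i) (Cminus v (RtoC (INR i)))
  end.
Definition cbinom (v : Cx) (j : nat) : Cx := Cdiv (falling v j) (RtoC (INR (Factorial.fact j))).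

Fixpoint csum (n : nat) (f : nat -> Cx) : Cx :=
  match n with
  | O => f O
  | S m => Cplus (csum m f) (f (S m))
  end.

(* De Moivre polynomial A_{n,k}(a_1,a_2,...): coefficient of x^n in
   (a_1 x + a_2 x^2 + ...)^k, computed as the coefficient of a k-fold product:
   A_{n,0} = [n = 0],  A_{n,k+1} = sum_{j=1}^{n} a_j A_{n-j,k}. *)
Fixpoint deMoivre (a : nat -> R) (k : nat) (n : nat) : R :=
  match k with
  | O => match n with O => 1 | S _ => 0 end
  | S k' => sum_f_R0 (fun j => if Nat.eqb j 0 then 0 else a j * deMoivre a k' (n - j)) n
  end.

Definition aseq (j : nat) : R := / INR (j + 2).

Definition kdelta (r : nat) : R := if Nat.eqb r 0 then 1 else 0.

Definition rho (r : nat) (v : Cx) : Cx :=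
  Cminus (RtoC (kdelta r))
    (csum (2 * r + 1) (fun m =>
       Cmult (RtoC ((-1) ^ m))
       (Cmult (cbinom v (2 * r + 1 - m))
         (RtoC (sum_f_R0 (fun k =>
             INR (dfact (2 * r + 2 * k)) / ((-1) ^ k * INR (Factorial.fact k))
             * deMoivre aseq k m) m))))).

(* Main.v *)
(** Substituting [z = 1 + s] in the integral over [[0,1]] and [t = n (1 + s)] in
    the Gamma integral gives
      [theta n v = 1 - (n/2) int_0^oo (g(s) - g(-s)) ds],
    where [g(s) = e^(-ns) (1+s)^(n+v)], extended by [0] to [s <= -1].  Writing
    [s - ln(1+s) = s^2/2 + s^2 h(s)], one has
      [g(s) = e^(-n s^2/2) e^(-n s^2 h(s)) (1+s)^v].
    Put [M = 2R + 1]; expanding the exponential in [h] to order [M] and each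
    [h^k (1+s)^v] in powers of [s] to order [M] approximates [g] by
    [e^(-n s^2/2)] times a polynomial, with an error bounded on all of the real line by
    [C (|s|^M e^(-n s^2/8) + |s|^Q e^(-n|s|/8))] with [Q >= R].  The integral of this
    error is [O(n^(-R-1))].  In [g(s) - g(-s)] only the odd powers of [s] survive, and
    [int_0^oo s^(2j+1) e^(-n s^2/2) ds = (2j)!!/n^(j+1)] produces the [rho_r]. *)

Require Import Defs.
From Stdlib Require Import Reals Lra Lia Factorial.
Open Scope R_scope.

(** * Finite Taylor expansions at 0 *)

(** The obstacle is the factor [n^k] that comes with [h^k]. It occurs only through powers of
    [x = n s^2], and a polynomial in [x] costs at most a constant times [e^(x/8)], which the
    Gaussian can spare. Hence one Taylor order serves all [k], uniformly in [n].

    The order [2R + 1] is what the target requires: [|s|^(2R+1)] against a Gaussian integrates to a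
    multiple of [n^(-R-1)], and the factor [n/2] in front of the integral costs one power of [n].
    Two decay rates appear because [s - ln(1+s)] dominates a multiple of [s^2] on [(-1, 1]] but
    grows only linearly at infinity.

    Only the behaviour at [0] matters, so expansions are finite, with a bounded remainder on
    [[-1/2, 1/2]]. This notion is stable under linear combinations, products and integration, and no
    convergence of power series is involved. Convergence of the integral of [g] at infinity is not
    proved in advance either: it follows from the domination of the error term. *)

Fixpoint horner (M : nat) (c : nat -> Cx) (s : R) : Cx :=
  match M with
  | O => RtoC 0
  | S M' => (c O + RtoC s * horner M' (fun p => c (S p)) s)%C
  end.

(* [f s = sum_(p < M) c_p s^p + O(s^M)], uniformly for [|s| <= 1/2]. *)
Definition expansion (M : nat) (f : R -> Cx) (c : nat -> Cx) : Prop :=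
  exists (r : R -> Cx) (B : R), forall s, Rabs s <= 1/2 ->
    Cmod (r s) <= B /\ f s = (horner M c s + RtoC (s ^ M) * r s)%C.

(** The coefficients of the Cauchy product of two power series. *)
Definition conv (c d : nat -> Cx) (p : nat) : Cx :=
  csum p (fun m => (c m * d (p - m)%nat)%C).

Lemma csum_ext n f g :
  (forall i, (i <= n)%nat -> f i = g i) -> csum n f = csum n g.
Proof.
  induction n as [|n IH]; intros H; simpl; [apply H; lia|].
  rewrite IH, (H (S n)); auto.
Qed.

Lemma csum_S_l n f : csum (S n) f = (f O + csum n (fun i => f (S i)))%C.
Proof.
  induction n as [|n IH]; [reflexivity|].
  change (csum (S (S n)) f) with (csum (S n) f + f (S (S n)))%C.
  rewrite IH; simpl; ring.
Qed.

Lemma csum_plus n f g :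
  csum n (fun i => (f i + g i)%C) = (csum n f + csum n g)%C.
Proof. induction n as [|n IH]; simpl; [|rewrite IH]; ring. Qed.

Lemma csum_minus n f g :
  csum n (fun i => (f i - g i)%C) = (csum n f - csum n g)%C.
Proof. induction n as [|n IH]; simpl; [|rewrite IH]; ring. Qed.

Lemma csum_scal n a f : csum n (fun i => (a * f i)%C) = (a * csum n f)%C.
Proof. induction n as [|n IH]; simpl; [|rewrite IH]; ring. Qed.

Lemma csum_exchange n m (f : nat -> nat -> Cx) :
  csum n (fun i => csum m (f i)) = csum m (fun j => csum n (fun i => f i j)).
Proof.
  induction n as [|n IH]; simpl; [reflexivity|].
  now rewrite IH, <- csum_plus.
Qed.

Lemma Cmod_csum n f : Cmod (csum n f) <= sum_f_R0 (fun i => Cmod (f i)) n.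
Proof.
  induction n as [|n IH]; simpl; [lra|].
  eapply Rle_trans; [apply Cmod_triangle|lra].
Qed.

Lemma RtoC_sum n (f : nat -> R) :
  RtoC (sum_f_R0 f n) = csum n (fun i => RtoC (f i)).
Proof.
  induction n as [|n IH]; simpl; [reflexivity|].
  now rewrite RtoC_plus, IH.
Qed.

Lemma horner_ext M c d s :
  (forall p, (p < M)%nat -> c p = d p) -> horner M c s = horner M d s.
Proof.
  revert c d; induction M as [|M IH]; intros c d H; simpl; [reflexivity|].
  rewrite (H O), (IH _ (fun p => d (S p))); [reflexivity| |lia].
  intros p Hp; apply H; lia.
Qed.

Lemma horner_lin M a c d s :
  horner M (fun p => (a * c p + d p)%C) s = (a * horner M c s + horner M d s)%C.
Proof.
  revert c d; induction M as [|M IH]; intros c d; simpl; [ring|].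
  rewrite (IH (fun p => c (S p)) (fun p => d (S p))); ring.
Qed.

Lemma expansion_ext M f g c d :
  (forall s, Rabs s <= 1/2 -> f s = g s) ->
  (forall p, (p < M)%nat -> c p = d p) -> expansion M f c -> expansion M g d.
Proof.
  intros Hf Hc (r & B & H); exists r, B; intros s Hs.
  destruct (H s Hs) as [H1 H2]; split; [assumption|].
  now rewrite <- Hf, H2, (horner_ext M c d) by auto.
Qed.

(** The Horner form makes peeling off the constant term exact: [f1] plays the part of [(f - c_0)/s]
    with the same remainder. Inductions on the order rest on this. *)
Lemma expansion_S M f c :
  expansion (S M) f c <->
  exists f1, expansion M f1 (fun p => c (S p)) /\
    forall s, Rabs s <= 1/2 -> f s = (c O + RtoC s * f1 s)%C.
Proof.
  split.
  - intros (r & B & H).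
    exists (fun s => horner M (fun p => c (S p)) s + RtoC (s ^ M) * r s)%C.
    split.
    + exists r, B; intros s Hs; split; [apply H, Hs|reflexivity].
    + intros s Hs; destruct (H s Hs) as [_ ->]; simpl; rewrite RtoC_mult; ring.
  - intros (f1 & (r & B & H) & Hf); exists r, B; intros s Hs.
    destruct (H s Hs) as [H1 H2]; split; [assumption|].
    rewrite (Hf s Hs), H2; simpl; rewrite RtoC_mult; ring.
Qed.

Lemma expansion_bounded M f c :
  expansion M f c -> exists B, 0 <= B /\ forall s, Rabs s <= 1/2 -> Cmod (f s) <= B.
Proof.
  revert f c; induction M as [|M IH]; intros f c H.
  - destruct H as (r & B & H); exists (Rabs B); split; [apply Rabs_pos|].
    intros s Hs; destruct (H s Hs) as [H1 ->]; simpl.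
    replace (0 + 1 * r s)%C with (r s) by ring.
    eapply Rle_trans; [exact H1|apply Rle_abs].
  - apply expansion_S in H; destruct H as (f1 & H1 & Hf).
    destruct (IH _ _ H1) as (B & HB & Hb).
    exists (Cmod (c O) + B); split.
    { pose proof (Cmod_ge_0 (c O)); lra. }
    intros s Hs; rewrite (Hf s Hs).
    eapply Rle_trans; [apply Cmod_triangle|].
    rewrite Cmod_mult, Cmod_R.
    specialize (Hb s Hs); pose proof (Cmod_ge_0 (f1 s)); pose proof (Rabs_pos s).
    nra.
Qed.

Lemma bounded_expansion f c B :
  (forall s, Rabs s <= 1/2 -> Cmod (f s) <= B) -> expansion 0 f c.
Proof.
  intros H; exists f, B; intros s Hs; split; [auto|simpl; ring].
Qed.

Lemma expansion_pred M f c : expansion (S M) f c -> expansion M f c.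
Proof.
  revert f c; induction M as [|M IH]; intros f c H.
  - destruct (expansion_bounded _ _ _ H) as (B & _ & HB).
    now apply bounded_expansion with B.
  - apply expansion_S in H; destruct H as (f1 & H1 & Hf).
    apply expansion_S; exists f1; auto.
Qed.

Lemma expansion_lin M a f g c d :
  expansion M f c -> expansion M g d ->
  expansion M (fun s => (a * f s + g s)%C) (fun p => (a * c p + d p)%C).
Proof.
  intros (r & B & H) (q & D & H').
  exists (fun s => a * r s + q s)%C, (Cmod a * B + D); intros s Hs.
  destruct (H s Hs) as [H1 ->], (H' s Hs) as [H2 ->]; split.
  - eapply Rle_trans; [apply Cmod_triangle|]; rewrite Cmod_mult.
    pose proof (Cmod_ge_0 a); nra.
  - rewrite horner_lin; ring.
Qed.

(** With [f = c_0 + s f1] and [g = d_0 + s g1], the product is [c_0 d_0 + s (c_0 g1 + f1 g)].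
    Keeping [g] whole in the last term lets the induction hypothesis apply, and matches the
    recursion of [conv] in its first summand. *)
Lemma expansion_mult M f g c d :
  expansion M f c -> expansion M g d -> expansion M (fun s => (f s * g s)%C) (conv c d).
Proof.
  revert f g c d; induction M as [|M IH]; intros f g c d Hf Hg.
  - destruct (expansion_bounded _ _ _ Hf) as (B & HB & H1).
    destruct (expansion_bounded _ _ _ Hg) as (D & HD & H2).
    apply bounded_expansion with (B * D); intros s Hs; rewrite Cmod_mult.
    apply Rmult_le_compat; auto using Cmod_ge_0.
  - pose proof (expansion_pred _ _ _ Hg) as Hg'.
    apply expansion_S in Hf; destruct Hf as (f1 & Hf1 & Ef).
    apply expansion_S in Hg; destruct Hg as (g1 & Hg1 & Eg).
    apply expansion_S; exists (fun s => (c O * g1 s + f1 s * g s)%C); split.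
    + eapply expansion_ext; [intros s _; reflexivity| |
        apply expansion_lin; [exact Hg1|exact (IH _ _ _ _ Hf1 Hg')]].
      intros p _; unfold conv; rewrite csum_S_l; reflexivity.
    + intros s Hs; rewrite (Ef s Hs), (Eg s Hs); unfold conv; simpl; ring.
Qed.

Lemma expansion_of_bound M f c B :
  (forall s, Rabs s <= 1/2 -> Cmod (f s - horner M c s) <= B * Rabs s ^ M) ->
  expansion M f c.
Proof.
  intros H; exists (fun s => (f s - horner M c s) / RtoC (s ^ M))%C, (Rabs B).
  intros s Hs; specialize (H s Hs).
  (* If [s^M = 0], the assumed bound forces the numerator to vanish, so the quotient by zero does no
     harm. *)
  destruct (Req_dec (s ^ M) 0) as [E|E].
  - rewrite RPow_abs, E, Rabs_R0, Rmult_0_r in H.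
    assert (E' : (f s - horner M c s)%C = RtoC 0).
    { apply Cmod_eq_0; pose proof (Cmod_ge_0 (f s - horner M c s)); lra. }
    rewrite E'; unfold Cdiv; rewrite Cmult_0_l, Cmult_0_r, Cmod_0; split.
    + apply Rabs_pos.
    + replace (f s) with ((f s - horner M c s) + horner M c s)%C by ring.
      rewrite E'; ring.
  - assert (EC : RtoC (s ^ M) <> RtoC 0) by (intros K; apply E; now injection K).
    split; [|field; assumption].
    rewrite Cmod_div, Cmod_R by assumption.
    pose proof (Rabs_pos_lt _ E).
    apply Rle_div_l; [lra|]; eapply Rle_trans; [exact H|].
    rewrite RPow_abs; apply Rmult_le_compat_r; [lra|apply Rle_abs].
Qed.

(** Componentwise, so that the real mean value inequality can be applied to [Re] and [Im]
    separately. *)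
Definition is_cderive (f : R -> Cx) (s : R) (l : Cx) : Prop :=
  is_derive (fun t => Re (f t)) s (Re l) /\ is_derive (fun t => Im (f t)) s (Im l).

Lemma is_cderive_horner M c s :
  is_cderive (horner (S M) c) s
    (horner M (fun p => (RtoC (INR (S p)) * c (S p))%C) s).
Proof.
  revert c; induction M as [|M IH]; intros c.
  - split; simpl; auto_derive; trivial; ring.
  - destruct (IH (fun p => c (S p))) as [H1 H2].
    set (q := horner (S M) (fun p => c (S p))) in *.
    set (d := horner M (fun p => RtoC (INR (S p)) * c (S (S p)))%C s) in *.
    (* Product rule for [s q(s)]: the weight [p + 1] splits into [1], which gives [q], and [p],
       which gives [s q']. *)
    assert (E : horner (S M) (fun p => (RtoC (INR (S p)) * c (S p))%C) s
                = (q s + RtoC s * d)%C).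
    { transitivity (horner (S M) (fun p => (RtoC 1 * c (S p)
                      + RtoC (INR p) * c (S p))%C) s).
      - apply horner_ext; intros p _; rewrite S_INR, RtoC_plus; ring.
      - rewrite horner_lin; unfold q, d; simpl horner; ring. }
    rewrite E; clear E.
    change (horner (S (S M)) c) with (fun t => (c O + RtoC t * q t)%C).
    split.
    + apply is_derive_ext with (fun t => Re (c O) + t * Re (q t)).
      { intros t; unfold Re, Im; simpl; ring. }
      replace (Re (q s + RtoC s * d)%C) with (0 + (1 * Re (q s) + s * Re d))
        by (unfold Re; simpl; ring).
      apply @is_derive_plus; [apply @is_derive_const|].
      apply (is_derive_mult (fun t => t) (fun t => Re (q t)));
        [apply @is_derive_id|exact H1|intros; apply Rmult_comm].
    + apply is_derive_ext with (fun t => Im (c O) + t * Im (q t)).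
      { intros t; unfold Re, Im; simpl; ring. }
      replace (Im (q s + RtoC s * d)%C) with (0 + (1 * Im (q s) + s * Im d))
        by (unfold Im; simpl; ring).
      apply @is_derive_plus; [apply @is_derive_const|].
      apply (is_derive_mult (fun t => t) (fun t => Im (q t)));
        [apply @is_derive_id|exact H2|intros; apply Rmult_comm].
Qed.

Lemma im_le_Cmod z : Rabs (Im z) <= Cmod z.
Proof. eapply Rle_trans; [apply Rmax_r|apply Rmax_Cmod]. Qed.

Lemma Cmod_le_Re_Im z : Cmod z <= Rabs (Re z) + Rabs (Im z).
Proof.
  replace z with (RtoC (Re z) + Ci * RtoC (Im z))%C
    by (destruct z; unfold Re, Im; apply injective_projections; simpl; ring).
  eapply Rle_trans; [apply Cmod_triangle|].
  rewrite Cmod_mult, !Cmod_R, Cmod_Ci; unfold Re, Im; simpl.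
  apply Req_le; f_equal; [|rewrite Rmult_1_l]; f_equal; ring.
Qed.

(** The difference between [f] and its Taylor polynomial vanishes at [0] and has derivative at most
    [B |s|^M] between [0] and [s]. The mean value inequality gives [B |s|^(M+1)] for each of [Re]
    and [Im], hence the constant [2 B]. *)
Lemma expansion_integral M f g c :
  (forall s, Rabs s <= 1/2 -> is_cderive f s (g s)) ->
  f 0 = c O -> expansion M g (fun p => (RtoC (INR (S p)) * c (S p))%C) ->
  expansion (S M) f c.
Proof.
  intros Hd H0 (r & B & Hg).
  apply expansion_of_bound with (2 * B); intros s Hs.
  set (e := fun t => (f t - horner (S M) c t)%C).
  set (de := fun t => (g t - horner M (fun p => (RtoC (INR (S p)) * c (S p))%C) t)%C).
  assert (HB : 0 <= B).
  { eapply Rle_trans; [apply Cmod_ge_0|apply (Hg 0)]; rewrite Rabs_R0; lra. }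
  assert (He0 : e 0 = RtoC 0) by (unfold e; simpl; rewrite H0; ring).
  assert (Hde : forall t, Rabs (t - 0) <= Rabs (s - 0) ->
            is_cderive e t (de t) /\ Cmod (de t) <= B * Rabs s ^ M).
  { intros t Ht; rewrite !Rminus_0_r in Ht.
    assert (Ht' : Rabs t <= 1/2) by lra; split.
    - destruct (Hd t Ht') as [A1 A2], (is_cderive_horner M c t) as [B1 B2].
      split; unfold e, de.
      + apply (is_derive_minus (fun t => Re (f t)) (fun t => Re (horner (S M) c t)));
          assumption.
      + apply (is_derive_minus (fun t => Im (f t)) (fun t => Im (horner (S M) c t)));
          assumption.
    - unfold de; destruct (Hg t Ht') as [Hr ->].
      match goal with |- Cmod ?z <= _ =>
        replace z with (RtoC (t ^ M) * r t)%C by ring end.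
      rewrite Cmod_mult, Cmod_R, <- RPow_abs, (Rmult_comm B).
      apply Rmult_le_compat; auto using Cmod_ge_0, pow_le, Rabs_pos.
      apply pow_incr; split; [apply Rabs_pos|assumption]. }
  assert (K1 : Rabs (Re (e s)) <= B * Rabs s ^ M * Rabs s).
  { replace (Re (e s)) with (Re (e s) - Re (e 0))
      by (rewrite He0, re_RtoC; ring).
    rewrite <- (Rminus_0_r s) at 3.
    apply (bounded_variation (fun t => Re (e t)) (fun t => Re (de t))).
    intros t Ht; destruct (Hde t Ht) as [[D1 _] L]; split; [exact D1|].
    eapply Rle_trans; [apply re_le_Cmod|exact L]. }
  assert (K2 : Rabs (Im (e s)) <= B * Rabs s ^ M * Rabs s).
  { replace (Im (e s)) with (Im (e s) - Im (e 0))
      by (rewrite He0, im_RtoC; ring).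
    rewrite <- (Rminus_0_r s) at 3.
    apply (bounded_variation (fun t => Im (e t)) (fun t => Im (de t))).
    intros t Ht; destruct (Hde t Ht) as [[_ D2] L]; split; [exact D2|].
    eapply Rle_trans; [apply im_le_Cmod|exact L]. }
  change (Cmod (e s) <= 2 * B * Rabs s ^ S M).
  eapply Rle_trans; [apply Cmod_le_Re_Im|rewrite <- tech_pow_Rmult; lra].
Qed.

(** * Expansions of powers, logarithms and [h] *)

Lemma rcpow_pos x w : 0 < x ->
  rcpow x w = (exp (Re w * ln x) * cos (Im w * ln x),
               exp (Re w * ln x) * sin (Im w * ln x)).
Proof.
  intros Hx; unfold rcpow, cexp; destruct (Rlt_dec 0 x) as [_|]; [|lra].
  replace (Re (w * RtoC (ln x))%C) with (Re w * ln x) by (unfold Re; simpl; ring).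
  replace (Im (w * RtoC (ln x))%C) with (Im w * ln x) by (unfold Im; simpl; ring).
  reflexivity.
Qed.

Lemma rcpow_neg x w : x <= 0 -> rcpow x w = RtoC 0.
Proof. intros Hx; unfold rcpow; destruct (Rlt_dec 0 x); [lra|reflexivity]. Qed.

Lemma Cmod_polar r a : 0 <= r -> Cmod (r * cos a, r * sin a) = r.
Proof.
  intros Hr; unfold Cmod; simpl fst; simpl snd.
  replace ((r * cos a) ^ 2 + (r * sin a) ^ 2) with (r ^ 2).
  - apply sqrt_pow2, Hr.
  - pose proof (sin2_cos2 a) as E; unfold Rsqr in E.
    replace ((r * cos a) ^ 2 + (r * sin a) ^ 2)
      with (r ^ 2 * (sin a * sin a + cos a * cos a)) by ring.
    rewrite E; ring.
Qed.

Lemma Cmod_rcpow x w : 0 < x -> Cmod (rcpow x w) = exp (Re w * ln x).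
Proof.
  intros Hx; rewrite (rcpow_pos x w Hx); apply Cmod_polar, Rlt_le, exp_pos.
Qed.

Lemma rcpow_real x a : 0 < x -> rcpow x (RtoC a) = RtoC (exp (a * ln x)).
Proof.
  intros Hx; rewrite (rcpow_pos x _ Hx), re_RtoC, im_RtoC, Rmult_0_l, cos_0, sin_0.
  unfold RtoC; f_equal; ring.
Qed.

Lemma rcpow_plus x w z : 0 < x -> rcpow x (w + z)%C = (rcpow x w * rcpow x z)%C.
Proof.
  intros Hx; rewrite !(rcpow_pos x _ Hx).
  replace (Re (w + z)%C * ln x) with (Re w * ln x + Re z * ln x)
    by (unfold Re; simpl; ring).
  replace (Im (w + z)%C * ln x) with (Im w * ln x + Im z * ln x)
    by (unfold Im; simpl; ring).
  rewrite exp_plus, cos_plus, sin_plus.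
  apply injective_projections; simpl; ring.
Qed.

Lemma is_cderive_rcpow v s : -1 < s ->
  is_cderive (fun t => rcpow (1 + t) v) s (v * rcpow (1 + s) (v - RtoC 1))%C.
Proof.
  intros Hs.
  assert (Hloc : locally s (fun t => 0 < 1 + t)).
  { assert (He : 0 < 1 + s) by lra.
    exists (mkposreal _ He); intros t Ht.
    unfold ball in Ht; simpl in Ht; unfold AbsRing_ball, abs, minus, plus, opp in Ht;
      simpl in Ht.
    apply Rabs_def2 in Ht; lra. }
  assert (Hv : exp (Re (v - RtoC 1)%C * ln (1 + s)) = exp (Re v * ln (1 + s)) / (1 + s)).
  { replace (Re (v - RtoC 1)%C * ln (1 + s)) with (Re v * ln (1 + s) + - ln (1 + s))
      by (unfold Re; simpl; ring).
    rewrite exp_plus, exp_Ropp, exp_ln by lra; reflexivity. }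
  assert (Hi : Im (v - RtoC 1)%C = Im v) by (unfold Im; simpl; ring).
  rewrite (rcpow_pos (1 + s)), Hv, Hi by lra.
  split.
  - apply is_derive_ext_loc with
      (fun t => exp (Re v * ln (1 + t)) * cos (Im v * ln (1 + t))).
    { revert Hloc; apply filter_imp; intros t Ht; now rewrite rcpow_pos. }
    auto_derive; [lra|]; unfold Re, Im; simpl; field; lra.
  - apply is_derive_ext_loc with
      (fun t => exp (Re v * ln (1 + t)) * sin (Im v * ln (1 + t))).
    { revert Hloc; apply filter_imp; intros t Ht; now rewrite rcpow_pos. }
    auto_derive; [lra|]; unfold Re, Im; simpl; field; lra.
Qed.

Lemma INR_fact_C_neq_0 p : RtoC (INR (fact p)) <> RtoC 0.
Proof. intros E; apply (INR_fact_neq_0 p); now injection E. Qed.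

Lemma falling_S_l v j : falling v (S j) = (v * falling (v - RtoC 1) j)%C.
Proof.
  induction j as [|j IH]; [simpl; ring|].
  change (falling v (S (S j))) with (falling v (S j) * (v - RtoC (INR (S j))))%C.
  rewrite IH, S_INR, RtoC_plus; simpl; ring.
Qed.

(** The coefficient form of [d/ds (1+s)^v = v (1+s)^(v-1)]. *)
Lemma cbinom_S v p :
  (RtoC (INR (S p)) * cbinom v (S p))%C = (v * cbinom (v - RtoC 1) p)%C.
Proof.
  unfold cbinom; rewrite falling_S_l, fact_simpl, mult_INR, RtoC_mult.
  pose proof (INR_fact_C_neq_0 p).
  assert (RtoC (INR (S p)) <> RtoC 0)
    by (intros E; apply (not_0_INR (S p)); [lia|now injection E]).
  field; split; assumption.
Qed.

Lemma RtoC_m1 : RtoC (-1) = (- RtoC 1)%C.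
Proof. rewrite <- RtoC_opp; reflexivity. Qed.

Lemma cbinom_m1 p : cbinom (- RtoC 1)%C p = RtoC ((-1) ^ p).
Proof.
  assert (E : falling (- RtoC 1)%C p = RtoC ((-1) ^ p * INR (fact p))).
  { induction p as [|p IH]; [simpl; now rewrite Rmult_1_l|].
    change (falling (- RtoC 1)%C (S p))
      with (falling (- RtoC 1)%C p * (- RtoC 1 - RtoC (INR p)))%C.
    rewrite IH, fact_simpl, mult_INR, S_INR; simpl pow.
    rewrite !RtoC_mult, RtoC_plus, RtoC_m1; ring. }
  unfold cbinom; rewrite E, RtoC_mult; field; apply INR_fact_C_neq_0.
Qed.

Lemma exp_nondecreasing x y : x <= y -> exp x <= exp y.
Proof.
  intros [H| ->]; [apply Rlt_le, exp_increasing, H|lra].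
Qed.

Lemma ln_1p_le s : -1 < s -> ln (1 + s) <= s.
Proof.
  intros Hs; rewrite <- (ln_exp s) at 2; apply ln_le; [lra|].
  apply exp_ineq1_le.
Qed.

(** Induction on the order for all [v] at once: differentiation lowers [v] by one and stays in the
    family, so order [M] for [v - 1] integrates to order [M + 1] for [v]. Only boundedness is left
    for the base case. *)
Lemma expansion_rcpow M v : expansion M (fun s => rcpow (1 + s) v) (cbinom v).
Proof.
  revert v; induction M as [|M IH]; intros v.
  - apply bounded_expansion with (exp (Rabs (Re v))); intros s Hs.
    apply Rabs_le_between in Hs.
    rewrite Cmod_rcpow by lra; apply exp_nondecreasing.
    (* The lower bound comes from [ln y <= y - 1] at [y = 1/(1+s) <= 2]. *)
    assert (Hl : Rabs (ln (1 + s)) <= 1).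
    { apply Rabs_le; pose proof (ln_1p_le s).
      assert (- ln (1 + s) <= / (1 + s) - 1).
      { rewrite <- ln_Rinv by lra.
        assert (0 < / (1 + s)) by (apply Rinv_0_lt_compat; lra).
        pose proof (ln_1p_le (/ (1 + s) - 1)) as K.
        replace (1 + (/ (1 + s) - 1)) with (/ (1 + s)) in K by ring; lra. }
      assert (/ (1 + s) <= 2)
        by (replace 2 with (/ (1/2)) by field; apply Rinv_le_contravar; lra).
      lra. }
    eapply Rle_trans; [apply Rle_abs|]; rewrite Rabs_mult.
    pose proof (Rabs_pos (Re v)); nra.
  - apply expansion_integral with (fun s => v * rcpow (1 + s) (v - RtoC 1))%C.
    + intros s Hs; apply is_cderive_rcpow; apply Rabs_le_between in Hs; lra.
    + rewrite Rplus_0_r, rcpow_pos, ln_1, !Rmult_0_r, exp_0, cos_0, sin_0 by lra.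
      unfold cbinom; simpl; apply injective_projections; simpl; field.
    (* [v X] is written [(v - 1) X + X] to fit the shape [a f + g]. *)
    + eapply expansion_ext; [| |apply (expansion_lin M (v - RtoC 1)%C _ _ _ _
        (IH (v - RtoC 1)%C) (IH (v - RtoC 1)%C))].
      * intros s _; simpl; ring.
      * intros p _; rewrite cbinom_S; ring.
Qed.

(** The binomial expansion at [v = 0], where every coefficient after the first vanishes. *)
Lemma expansion_one M :
  expansion M (fun _ => RtoC 1) (fun p => RtoC (match p with O => 1 | S _ => 0 end)).
Proof.
  eapply expansion_ext; [| |apply (expansion_rcpow M (RtoC 0))].
  - intros s Hs; apply Rabs_le_between in Hs; simpl.
    rewrite rcpow_real by lra; now rewrite Rmult_0_l, exp_0.
  - intros [|p] _; unfold cbinom.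
    + simpl; field; injection; lra.
    + rewrite falling_S_l; unfold Cdiv; ring.
Qed.

Definition phi (s : R) : R := s - ln (1 + s).

Definition phic (p : nat) : R :=
  match p with S (S q) => (-1) ^ q / INR (q + 2) | _ => 0 end.

(** Integrates [phi' = 1 - 1/(1+s)], using the binomial expansion at exponent [-1]. Integration
    gains one order, which [expansion_pred] drops. *)
Lemma expansion_phi M : expansion M (fun s => RtoC (phi s)) (fun p => RtoC (phic p)).
Proof.
  apply expansion_pred, expansion_integral
    with (fun s => (- RtoC 1) * rcpow (1 + s) (- RtoC 1) + RtoC 1)%C.
  - intros s Hs; apply Rabs_le_between in Hs.
    rewrite <- RtoC_m1, rcpow_real, <- RtoC_mult, <- RtoC_plus by lra.
    replace (-1 * ln (1 + s)) with (- ln (1 + s)) by ring.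
    rewrite exp_Ropp, exp_ln by lra.
    split; unfold phi, RtoC, Re, Im; simpl.
    + auto_derive; [lra|field; lra].
    + apply @is_derive_const.
  - unfold phi; rewrite Rplus_0_r, ln_1; simpl; f_equal; ring.
  - eapply expansion_ext;
      [| |apply expansion_lin; [apply expansion_rcpow|apply expansion_one]].
    + intros s _; reflexivity.
    + intros p _; cbv beta; rewrite cbinom_m1, <- RtoC_m1, <- !RtoC_mult, <- RtoC_plus.
      f_equal; destruct p as [|p]; [simpl; ring|].
      replace (S (S p)) with (p + 2)%nat by lia; unfold phic.
      replace (p + 2)%nat with (S (S p)) by lia.
      replace (p + 2)%nat with (S (S p)) by lia.
      simpl pow; field; apply not_0_INR; lia.
Qed.

(* The [h] of the header; its limit at [0] is [0]. *)
Definition hfun (s : R) : R :=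
  if Req_EM_T s 0 then 0 else phi s / s ^ 2 - 1/2.

Lemma phi_hfun s : phi s = s ^ 2 / 2 + s ^ 2 * hfun s.
Proof.
  unfold hfun; destruct (Req_EM_T s 0) as [->|Hs]; [|field; assumption].
  unfold phi; rewrite Rplus_0_r, ln_1; field.
Qed.

(** From [phi = s^2/2 - s^3/3 + s^4/4 - ...] one gets [h = -s/3 + s^2/4 - ...]. This is the origin
    of the arguments [1/3, 1/4, ...] of the De Moivre polynomials and of the sign [(-1)^m]. *)
Definition hcoef (j : nat) : R := if Nat.eqb j 0 then 0 else (-1) ^ j * aseq j.

Lemma expansion_hfun M : expansion M (fun s => RtoC (hfun s)) (fun p => RtoC (hcoef p)).
Proof.
  apply expansion_pred.
  (* Two orders are spent on the division by [s^2]. The third keeps the order positive, so that the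
     value at [s = 0] is forced to be [hcoef 0 = 0], in agreement with the separate case in
     [hfun]. *)
  pose proof (expansion_phi (S (S (S M)))) as H.
  apply expansion_S in H; destruct H as (f1 & H & E1).
  apply expansion_S in H; destruct H as (f2 & H & E2).
  assert (Hh : expansion (S M) (fun s => - RtoC (1/2) * RtoC 1 + f2 s)%C
                (fun p => RtoC (hcoef p))).
  { eapply expansion_ext; [| |apply expansion_lin; [apply expansion_one|exact H]].
    - intros s _; reflexivity.
    - intros p _; cbv beta; rewrite <- RtoC_opp, <- RtoC_mult, <- RtoC_plus; f_equal.
      destruct p as [|p]; unfold hcoef, phic, aseq; simpl Nat.eqb; cbv iota.
      + simpl; field.
      + unfold Rdiv; ring. }
  eapply expansion_ext; [|intros p _; reflexivity|exact Hh].
  intros s Hs; cbv beta; unfold hfun; destruct (Req_EM_T s 0) as [->|Hs0].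
  - destruct Hh as (r & B & Hh); destruct (Hh 0) as [_ ->]; [rewrite Rabs_R0; lra|].
    simpl; unfold hcoef; simpl; rewrite Rmult_0_l; ring.
  - assert (Hc : RtoC s <> RtoC 0) by (intros K; apply Hs0; now injection K).
    assert (E : f2 s = RtoC (phi s / s ^ 2)).
    { replace (s ^ 2) with (s * s) by ring.
      rewrite RtoC_div, RtoC_mult, (E1 s Hs), (E2 s Hs) by nra.
      simpl phic; field; assumption. }
    rewrite E, RtoC_minus; ring.
Qed.

(** The recursion of [deMoivre] is a Cauchy product with the series of [aseq]; the signs [(-1)^i]
    and [(-1)^(p-i)] combine to [(-1)^p]. *)
Lemma expansion_hfun_pow M k :
  expansion M (fun s => RtoC (hfun s ^ k))
    (fun m => RtoC ((-1) ^ m * deMoivre aseq k m)).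
Proof.
  induction k as [|k IH].
  - eapply expansion_ext; [| |apply expansion_one]; [reflexivity|].
    intros [|p] _; f_equal; simpl; ring.
  - eapply expansion_ext; [| |apply expansion_mult; [apply expansion_hfun|apply IH]].
    + intros s _; cbv beta; now rewrite <- RtoC_mult.
    + intros p _; unfold conv; cbn [deMoivre].
      rewrite scal_sum, RtoC_sum; apply csum_ext; intros i Hi; cbv beta.
      rewrite <- RtoC_mult; f_equal; unfold hcoef.
      destruct (Nat.eqb i 0); [ring|].
      replace ((-1) ^ p) with ((-1) ^ i * (-1) ^ (p - i))
        by (rewrite <- pow_add; f_equal; lia).
      ring.
Qed.

(* The coefficients of [h^k (1+s)^v] in powers of [s]. *)
Definition ccoef (v : Cx) (k : nat) : nat -> Cx :=
  conv (fun m => RtoC ((-1) ^ m * deMoivre aseq k m)) (cbinom v).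

Lemma expansion_hfun_pow_rcpow M v k :
  expansion M (fun s => (RtoC (hfun s ^ k) * rcpow (1 + s) v)%C) (ccoef v k).
Proof. apply expansion_mult; [apply expansion_hfun_pow|apply expansion_rcpow]. Qed.

(** * Pointwise approximation of the integrand *)

(** The derivative of [phi - t^2/4] is [t (1-t) / (2 (1+t))], which has the sign of [t] on [(-1, 1]]
    up to zeros, and the difference vanishes at [0]. *)
Lemma phi_ge_quadratic s : -1 < s <= 1 -> s ^ 2 / 4 <= phi s.
Proof.
  intros Hs.
  destruct (MVT_gen (fun t => phi t - t ^ 2 / 4) 0 s
    (fun t => t * (1 - t) / (2 * (1 + t)))) as (c & Hc & E).
  - intros t Ht; assert (-1 < t).
    { destruct (Rle_dec 0 s); [rewrite Rmin_left in Ht|rewrite Rmin_right in Ht]; lra. }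
    unfold phi; auto_derive; [lra|field; lra].
  - intros t Ht; assert (-1 < t).
    { destruct (Rle_dec 0 s); [rewrite Rmin_left in Ht|rewrite Rmin_right in Ht]; lra. }
    apply continuity_pt_filterlim.
    apply (ex_derive_continuous (fun t => phi t - t ^ 2 / 4)).
    unfold phi; auto_derive; lra.
  - assert (E0 : phi 0 = 0) by (unfold phi; rewrite Rplus_0_r, ln_1; ring).
    rewrite E0 in E.
    assert (Hsign : 0 <= c * (1 - c) / (2 * (1 + c)) * (s - 0)).
    { replace (c * (1 - c) / (2 * (1 + c)) * (s - 0))
        with (c * s * ((1 - c) * / (2 * (1 + c)))) by (unfold Rdiv; ring).
      destruct (Rle_dec 0 s) as [H|H].
      - rewrite Rmin_left, Rmax_right in Hc by lra.
        apply Rmult_le_pos; [nra|].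
        apply Rmult_le_pos; [lra|apply Rlt_le, Rinv_0_lt_compat; lra].
      - rewrite Rmin_right, Rmax_left in Hc by lra.
        apply Rmult_le_pos; [nra|].
        apply Rmult_le_pos; [lra|apply Rlt_le, Rinv_0_lt_compat; lra]. }
    lra.
Qed.

(** The slope [1/8] is chosen so that the quadratic bound starts the comparison: it gives
    [phi(1/2) >= 1/16]. Beyond that point [phi' = t/(1+t)] is at least [1/3]. *)
Lemma phi_ge_linear s : 1/2 <= s -> s / 8 <= phi s.
Proof.
  intros Hs.
  destruct (MVT_gen (fun t => phi t - t / 8) (1/2) s
    (fun t => t / (1 + t) - 1/8)) as (c & Hc & E).
  - intros t Ht; rewrite Rmin_left in Ht by lra.
    unfold phi; auto_derive; [lra|field; lra].
  - intros t Ht; rewrite Rmin_left in Ht by lra; apply continuity_pt_filterlim.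
    apply (ex_derive_continuous (fun t => phi t - t / 8)).
    unfold phi; auto_derive; lra.
  - rewrite Rmin_left, Rmax_right in Hc by lra.
    pose proof (phi_ge_quadratic (1/2)) as H.
    assert (1/8 <= c / (1 + c)) by (apply (Rle_div_r (1/8) c); lra).
    assert (0 <= (c / (1 + c) - 1/8) * (s - 1/2)) by (apply Rmult_le_pos; lra).
    lra.
Qed.

(* The remainder of the Taylor series of [exp] after [K] terms. *)
Fixpoint exp_rem (K : nat) (w : R) : R :=
  match K with
  | O => exp w
  | S K' => exp_rem K' w - w ^ K' / INR (fact K')
  end.

Lemma exp_rem_sum K w :
  exp w = sum_f_R0 (fun k => w ^ k / INR (fact k)) K + exp_rem (S K) w.
Proof.
  induction K as [|K IH]; [simpl; field|].
  rewrite tech5; change (exp_rem (S (S K)) w)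
    with (exp_rem (S K) w - w ^ (S K) / INR (fact (S K))).
  rewrite IH at 1; ring.
Qed.

Lemma is_derive_exp_rem K w : is_derive (exp_rem (S K)) w (exp_rem K w).
Proof.
  induction K as [|K IH].
  - simpl; auto_derive; trivial; ring.
  - apply (is_derive_minus (exp_rem (S K)) (fun t => t ^ S K / INR (fact (S K))));
      [exact IH|].
    auto_derive; trivial.
    change (match K with 0%nat => 1 | S _ => INR K + 1 end) with (INR (S K)).
    change (fact K + K * fact K)%nat with (fact (S K)).
    rewrite fact_simpl, mult_INR; simpl pred.
    field; split; [apply INR_fact_neq_0|apply not_0_INR; lia].
Qed.

Lemma exp_rem_0 K : exp_rem (S K) 0 = 0.
Proof.
  induction K as [|K IH]; [simpl; rewrite exp_0; field|].
  change (exp_rem (S (S K)) 0) with (exp_rem (S K) 0 - 0 ^ (S K) / INR (fact (S K))).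
  rewrite IH, pow_i by lia; unfold Rdiv; ring.
Qed.

(** Each remainder is a primitive of the preceding one and vanishes at [0], so the mean value
    theorem gives one factor [w] per step. The maximum covers both signs of [w], since the
    intermediate point lies between [0] and [w]. *)
Lemma exp_rem_bound K w : Rabs (exp_rem K w) <= Rabs w ^ K * Rmax 1 (exp w).
Proof.
  revert w; induction K as [|K IH]; intros w.
  - simpl; rewrite Rabs_pos_eq by apply Rlt_le, exp_pos.
    rewrite Rmult_1_l; apply Rmax_r.
  - destruct (MVT_gen (exp_rem (S K)) 0 w (exp_rem K)) as (c & Hc & E).
    + intros t _; apply is_derive_exp_rem.
    + intros t _; apply continuity_pt_filterlim, (ex_derive_continuous (exp_rem (S K))).
      exists (exp_rem K t); apply is_derive_exp_rem.
    + rewrite exp_rem_0, !Rminus_0_r in E; rewrite E, Rabs_mult.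
      rewrite <- tech_pow_Rmult, Rmult_assoc, (Rmult_comm (Rabs w)).
      apply Rmult_le_compat_r; [apply Rabs_pos|].
      eapply Rle_trans; [apply IH|].
      assert (Hcw : Rabs c <= Rabs w /\ Rmax 1 (exp c) <= Rmax 1 (exp w)).
      { destruct (Rle_dec 0 w).
        - rewrite Rmin_left, Rmax_right in Hc by lra; split.
          + rewrite !Rabs_pos_eq; lra.
          + apply Rle_max_compat_l, exp_nondecreasing; lra.
        - rewrite Rmin_right, Rmax_left in Hc by lra; split.
          + rewrite !Rabs_left1; lra.
          + rewrite (Rmax_left 1 (exp c)); [apply Rmax_l|].
            rewrite <- exp_0; apply exp_nondecreasing; lra. }
      apply Rmult_le_compat; try apply Hcw.
      * apply pow_le, Rabs_pos.
      * eapply Rle_trans; [|apply Rmax_l]; lra.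
      * apply pow_incr; split; [apply Rabs_pos|apply Hcw].
Qed.

(** Write [x^k] as [8^k (x/8)^k] and bound [8^k] by [8^K]. The point is the small rate [1/8]: the
    bound can be multiplied by [e^(-x/2)] or [e^(-x/4)] and still leave [e^(-x/8)]. *)
Lemma exp_sum_le K x : 0 <= x ->
  sum_f_R0 (fun k => x ^ k / INR (fact k)) K <= 8 ^ K * exp (x / 8).
Proof.
  intros Hx; eapply Rle_trans; [|apply Rmult_le_compat_l;
    [apply pow_le; lra|apply (exp_ge_taylor (x / 8) K); lra]].
  rewrite scal_sum; apply sum_Rle; intros k Hk.
  replace x with (8 * (x / 8)) at 1 by field; rewrite Rpow_mult_distr.
  unfold Rdiv at 1; rewrite Rmult_assoc, Rmult_comm.
  apply Rmult_le_compat_l; [|apply Rle_pow; [lra|lia]].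
  apply Rmult_le_pos; [apply pow_le; lra|].
  apply Rlt_le, Rinv_0_lt_compat, INR_fact_lt_0.
Qed.

Lemma pow_le_exp K x : 0 <= x -> x ^ K <= 8 ^ K * INR (fact K) * exp (x / 8).
Proof.
  intros Hx; pose proof (INR_fact_lt_0 K) as HK.
  pose proof (exp_sum_le K x Hx) as H.
  assert (x ^ K / INR (fact K) <= sum_f_R0 (fun k => x ^ k / INR (fact k)) K).
  { destruct K as [|K]; [simpl; lra|]; rewrite tech5.
    assert (0 <= sum_f_R0 (fun k => x ^ k / INR (fact k)) K); [|lra].
    apply cond_pos_sum; intros k; apply Rmult_le_pos; [apply pow_le; lra|].
    apply Rlt_le, Rinv_0_lt_compat, INR_fact_lt_0. }
  assert (x ^ K / INR (fact K) <= 8 ^ K * exp (x / 8)) as L by lra.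
  apply (Rle_div_l (x ^ K) _ _ HK) in L; lra.
Qed.

(** Merges the constants of finitely many estimates into one; adding them avoids maxima. *)
Lemma uniform_bound (Q : R -> Prop) (F : nat -> R -> R) (G : R -> R) K :
  (forall s, 0 <= G s) ->
  (forall k, exists B, 0 <= B /\ forall s, Q s -> F k s <= B * G s) ->
  exists B, 0 <= B /\ forall k s, (k <= K)%nat -> Q s -> F k s <= B * G s.
Proof.
  intros HG H; induction K as [|K (B & HB & IH)].
  - destruct (H O) as (B & HB & HF); exists B; split; [assumption|].
    intros k s Hk Hs; replace k with O by lia; auto.
  - destruct (H (S K)) as (D & HD & HF); exists (B + D); split; [lra|].
    intros k s Hk Hs; specialize (HG s); rewrite Rmult_plus_distr_r.
    pose proof (Rmult_le_pos _ _ HB HG); pose proof (Rmult_le_pos _ _ HD HG).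
    destruct (Nat.eq_dec k (S K)) as [->|Hne].
    + specialize (HF s Hs); lra.
    + specialize (IH k s); assert (F k s <= B * G s) by (apply IH; [lia|auto]); lra.
Qed.

(** The extension by [0] to [s <= -1] is built into the default value of [rcpow]. *)
Definition gfun (n : R) (v : Cx) (s : R) : Cx :=
  (RtoC (exp (- (n * s))) * rcpow (1 + s) (RtoC n + v))%C.

(* [e^(-n s^2/2) pfun] is the approximation of [gfun]. *)
Definition pfun (n : R) (v : Cx) (K : nat) (s : R) : Cx :=
  csum K (fun k => (RtoC ((- (n * s ^ 2)) ^ k / INR (fact k))
                    * horner (S K) (ccoef v k) s)%C).

Lemma gfun_phi n v s : -1 < s ->
  gfun n v s = (RtoC (exp (- (n * phi s))) * rcpow (1 + s) v)%C.
Proof.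
  intros Hs; unfold gfun; rewrite rcpow_plus, rcpow_real by lra.
  rewrite Cmult_assoc, <- RtoC_mult, <- exp_plus; do 3 f_equal; unfold phi; ring.
Qed.

Lemma Cmod_csum_exp_le K B x (u : nat -> Cx) : 0 <= x ->
  (forall k, (k <= K)%nat -> Cmod (u k) <= B) -> 0 <= B ->
  Cmod (csum K (fun k => (RtoC ((- x) ^ k / INR (fact k)) * u k)%C))
  <= B * (8 ^ K * exp (x / 8)).
Proof.
  intros Hx Hu HB; eapply Rle_trans; [apply Cmod_csum|].
  eapply Rle_trans; [|apply Rmult_le_compat_l; [exact HB|apply exp_sum_le, Hx]].
  rewrite scal_sum; apply sum_Rle; intros k Hk.
  rewrite Cmod_mult, Cmod_R; apply Rmult_le_compat; auto using Rabs_pos, Cmod_ge_0.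
  unfold Rdiv; rewrite Rabs_mult, <- RPow_abs, Rabs_Ropp, (Rabs_pos_eq x) by lra.
  rewrite (Rabs_pos_eq (/ _)); [lra|].
  apply Rlt_le, Rinv_0_lt_compat, INR_fact_lt_0.
Qed.

(** With [x = n s^2] and [w = -x h(s)], the exponential factor is [e^(-x/2) e^w]. Two errors arise:
    the Taylor errors of [h^k (1+s)^v], weighted by [(-x)^k/k!], and the remainder of [e^w]. Each
    supplies [|s|^(K+1)], and the powers of [x] are paid for by part of the Gaussian. *)
Lemma gfun_near v K : exists B, 0 <= B /\ forall n s, 0 < n -> Rabs s <= 1/2 ->
  Cmod (gfun n v s - RtoC (exp (- (n * s ^ 2 / 2))) * pfun n v K s)
  <= B * (Rabs s ^ S K * exp (- (n * s ^ 2 / 8))).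
Proof.
  destruct (uniform_bound (fun s => Rabs s <= 1/2)
    (fun k s => Cmod (RtoC (hfun s ^ k) * rcpow (1 + s) v
                      - horner (S K) (ccoef v k) s))
    (fun s => Rabs s ^ S K) K) as (B1 & HB1 & H1).
  { intros s; apply pow_le, Rabs_pos. }
  { intros k; destruct (expansion_hfun_pow_rcpow (S K) v k) as (r & B & H).
    exists (Rabs B); split; [apply Rabs_pos|]; intros s Hs.
    destruct (H s Hs) as [Hr ->].
    match goal with |- Cmod ?z <= _ =>
      replace z with (RtoC (s ^ S K) * r s)%C by ring end.
    rewrite Cmod_mult, Cmod_R, <- RPow_abs, Rmult_comm.
    apply Rmult_le_compat_r; [apply pow_le, Rabs_pos|].
    pose proof (Rle_abs B); lra. }
  destruct (expansion_bounded 0 _ _ (expansion_rcpow 0 v)) as (B2 & HB2 & H2).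
  (* [h] vanishes at [0], so [w^(K+1)] carries [|s|^(K+1)] besides [x^(K+1)]. *)
  assert (exists H, 0 <= H /\ forall s, Rabs s <= 1/2 -> Rabs (hfun s) <= H * Rabs s)
    as (H & HH & H3).
  { destruct (expansion_hfun 1) as (r & B & Hr).
    exists (Rabs B); split; [apply Rabs_pos|]; intros s Hs.
    destruct (Hr s Hs) as [Hb E].
    rewrite <- Cmod_R, E; simpl; unfold hcoef; simpl.
    match goal with |- Cmod ?z <= _ =>
      replace z with (RtoC s * r s)%C by (rewrite Rmult_1_r; ring) end.
    rewrite Cmod_mult, Cmod_R, Rmult_comm.
    apply Rmult_le_compat_r; [apply Rabs_pos|]; pose proof (Rle_abs B); lra. }
  exists (B1 * 8 ^ K + H ^ S K * (8 ^ S K * INR (fact (S K))) * B2).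
  assert (HC : 0 <= H ^ S K * (8 ^ S K * INR (fact (S K))) * B2).
  { apply Rmult_le_pos; [|assumption].
    apply Rmult_le_pos; [apply pow_le; assumption|].
    apply Rmult_le_pos; [apply pow_le; lra|apply pos_INR]. }
  split.
  { apply Rplus_le_le_0_compat; [|assumption].
    apply Rmult_le_pos; [assumption|apply pow_le; lra]. }
  intros n s Hn Hs.
  pose proof (proj1 (Rabs_le_between s (1/2)) Hs) as Hs'.
  set (x := n * s ^ 2); assert (Hx : 0 <= x) by (unfold x; nra).
  set (w := - (x * hfun s)).
  assert (Ew : exp (- (n * phi s)) = exp (- (x / 2)) * exp w).
  { rewrite <- exp_plus; f_equal; rewrite phi_hfun; unfold w, x; field. }
  set (u := fun k => (RtoC (hfun s ^ k) * rcpow (1 + s) v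
                      - horner (S K) (ccoef v k) s)%C).
  assert (E : (gfun n v s - RtoC (exp (- (x / 2))) * pfun n v K s)%C
    = (RtoC (exp (- (x / 2)))
         * csum K (fun k => RtoC ((- x) ^ k / INR (fact k)) * u k)
       + RtoC (exp (- (x / 2)) * exp_rem (S K) w) * rcpow (1 + s) v)%C).
  { rewrite gfun_phi, Ew, (exp_rem_sum K w) by lra.
    rewrite Rmult_plus_distr_l, RtoC_plus, (RtoC_mult _ (sum_f_R0 _ _)), RtoC_sum.
    assert (Es : (csum K (fun k => RtoC (w ^ k / INR (fact k))) * rcpow (1 + s) v
        = csum K (fun k => RtoC ((- x) ^ k / INR (fact k)) * u k) + pfun n v K s)%C).
    { unfold pfun; rewrite <- csum_plus, Cmult_comm, <- csum_scal.
      apply csum_ext; intros k _; unfold u; fold x.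
      replace (w ^ k / INR (fact k)) with ((- x) ^ k / INR (fact k) * hfun s ^ k).
      - rewrite RtoC_mult; ring.
      - unfold w; replace (- (x * hfun s)) with (- x * hfun s) by ring.
        rewrite Rpow_mult_distr; unfold Rdiv; ring. }
    transitivity (RtoC (exp (- (x / 2)))
        * (csum K (fun k => RtoC (w ^ k / INR (fact k))) * rcpow (1 + s) v
           - pfun n v K s)
        + RtoC (exp (- (x / 2)) * exp_rem (S K) w) * rcpow (1 + s) v)%C;
      [|rewrite Es]; ring. }
  fold x.
  rewrite E; clear E.
  eapply Rle_trans; [apply Cmod_triangle|].
  rewrite Rmult_plus_distr_r; apply Rplus_le_compat.
  - rewrite Cmod_mult, Cmod_R, Rabs_pos_eq by apply Rlt_le, exp_pos.
    eapply Rle_trans; [apply Rmult_le_compat_l; [apply Rlt_le, exp_pos|]|].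
    { apply (Cmod_csum_exp_le K (B1 * Rabs s ^ S K) x u Hx).
      - intros k Hk; apply (H1 k s Hk Hs).
      - apply Rmult_le_pos; [assumption|apply pow_le, Rabs_pos]. }
    replace (exp (- (x / 2)) * (B1 * Rabs s ^ S K * (8 ^ K * exp (x / 8))))
      with (B1 * 8 ^ K * (Rabs s ^ S K * (exp (- (x / 2)) * exp (x / 8)))) by ring.
    apply Rmult_le_compat_l; [apply Rmult_le_pos; [assumption|apply pow_le; lra]|].
    apply Rmult_le_compat_l; [apply pow_le, Rabs_pos|].
    rewrite <- exp_plus; apply exp_nondecreasing; lra.
  - rewrite Cmod_mult, Cmod_R, Rabs_mult.
    rewrite (Rabs_pos_eq (exp _)) by apply Rlt_le, exp_pos.
    (* If [w > 0], [e^w] eats into the Gaussian. But [e^(-x/2) e^w = e^(-n phi)], and [phi >= s^2/4]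
       still leaves [e^(-x/4)]. *)
    assert (Hmax : exp (- (x / 2)) * Rmax 1 (exp w) <= exp (- (x / 4))).
    { rewrite <- RmaxRmult by apply Rlt_le, exp_pos.
      apply Rmax_lub.
      - rewrite Rmult_1_r; apply exp_nondecreasing; lra.
      - rewrite <- Ew; apply exp_nondecreasing.
        pose proof (phi_ge_quadratic s); unfold x; nra. }
    assert (Hw : Rabs w ^ S K <= H ^ S K * Rabs s ^ S K
                   * (8 ^ S K * INR (fact (S K)) * exp (x / 8))).
    { unfold w; rewrite Rabs_Ropp, Rabs_mult, (Rabs_pos_eq x) by assumption.
      rewrite Rpow_mult_distr, Rmult_comm, <- (Rpow_mult_distr H).
      apply Rmult_le_compat; auto using pow_le, Rabs_pos, pow_le_exp.
      apply pow_incr; split; [apply Rabs_pos|auto]. }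
    assert (Hr : exp (- (x / 2)) * Rabs (exp_rem (S K) w)
       <= H ^ S K * (8 ^ S K * INR (fact (S K))) * (Rabs s ^ S K * exp (- (x / 8)))).
    { eapply Rle_trans; [apply Rmult_le_compat_l;
        [apply Rlt_le, exp_pos|apply exp_rem_bound]|].
      replace (exp (- (x / 2)) * (Rabs w ^ S K * Rmax 1 (exp w)))
        with (Rabs w ^ S K * (exp (- (x / 2)) * Rmax 1 (exp w))) by ring.
      eapply Rle_trans; [apply Rmult_le_compat; [| |exact Hw|exact Hmax]|].
      - apply pow_le, Rabs_pos.
      - apply Rmult_le_pos; [apply Rlt_le, exp_pos|].
        eapply Rle_trans; [|apply Rmax_l]; lra.
      - apply Req_le.
        replace (- (x / 8)) with (x / 8 + - (x / 4)) by field.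
        rewrite exp_plus; ring. }
    replace (H ^ S K * (8 ^ S K * INR (fact (S K))) * B2
        * (Rabs s ^ S K * exp (- (x / 8))))
      with (H ^ S K * (8 ^ S K * INR (fact (S K)))
        * (Rabs s ^ S K * exp (- (x / 8))) * B2) by ring.
    apply Rmult_le_compat; auto using Cmod_ge_0.
    apply Rmult_le_pos; [apply Rlt_le, exp_pos|apply Rabs_pos].
Qed.

Lemma one_le_pow_double t M : 1/2 <= t -> 1 <= 2 ^ M * t ^ M.
Proof.
  intros Ht; rewrite <- Rpow_mult_distr, <- (pow1 M); apply pow_incr; lra.
Qed.

Lemma horner_far M c : exists B, 0 <= B /\ forall s, 1/2 <= Rabs s ->
  Cmod (horner M c s) <= B * Rabs s ^ M.
Proof.
  revert c; induction M as [|M IH]; intros c.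
  - exists 0; split; [lra|]; intros s _; simpl; rewrite Cmod_0; lra.
  - destruct (IH (fun p => c (S p))) as (B & HB & H).
    exists (Cmod (c O) * 2 ^ S M + B); pose proof (Cmod_ge_0 (c O)) as H0; split.
    { apply Rplus_le_le_0_compat; [|assumption].
      apply Rmult_le_pos; [assumption|apply pow_le; lra]. }
    intros s Hs; simpl horner; eapply Rle_trans; [apply Cmod_triangle|].
    rewrite Cmod_mult, Cmod_R, Rmult_plus_distr_r; apply Rplus_le_compat.
    + pose proof (one_le_pow_double (Rabs s) (S M) Hs).
      rewrite Rmult_assoc; nra.
    + rewrite <- tech_pow_Rmult.
      replace (B * (Rabs s * Rabs s ^ M)) with (Rabs s * (B * Rabs s ^ M)) by ring.
      apply Rmult_le_compat_l; [apply Rabs_pos|auto].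
Qed.

(** Away from [0] no cancellation is required: the polynomial approximation is by itself no larger
    than the allowed error, as lower powers of [|s|] are dominated by [|s|^(K+1)]. *)
Lemma pfun_far v K : exists B, 0 <= B /\ forall n s, 0 < n -> 1/2 <= Rabs s ->
  Cmod (RtoC (exp (- (n * s ^ 2 / 2))) * pfun n v K s)
  <= B * (Rabs s ^ S K * exp (- (n * s ^ 2 / 8))).
Proof.
  destruct (uniform_bound (fun s => 1/2 <= Rabs s)
    (fun k s => Cmod (horner (S K) (ccoef v k) s))
    (fun s => Rabs s ^ S K) K) as (B & HB & H).
  { intros s; apply pow_le, Rabs_pos. }
  { intros k; apply horner_far. }
  exists (B * 8 ^ K); split; [apply Rmult_le_pos; [assumption|apply pow_le; lra]|].
  intros n s Hn Hs.
  set (x := n * s ^ 2); assert (Hx : 0 <= x) by (unfold x; nra).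
  rewrite Cmod_mult, Cmod_R, Rabs_pos_eq by apply Rlt_le, exp_pos.
  eapply Rle_trans; [apply Rmult_le_compat_l; [apply Rlt_le, exp_pos|]|].
  { apply (Cmod_csum_exp_le K (B * Rabs s ^ S K) x _ Hx).
    - intros k Hk; apply (H k s Hk Hs).
    - apply Rmult_le_pos; [assumption|apply pow_le, Rabs_pos]. }
  replace (exp (- (x / 2)) * (B * Rabs s ^ S K * (8 ^ K * exp (x / 8))))
    with (B * 8 ^ K * (Rabs s ^ S K * (exp (- (x / 2)) * exp (x / 8)))) by ring.
  apply Rmult_le_compat_l; [apply Rmult_le_pos; [assumption|apply pow_le; lra]|].
  apply Rmult_le_compat_l; [apply pow_le, Rabs_pos|].
  rewrite <- exp_plus; apply exp_nondecreasing; lra.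
Qed.

Lemma Cmod_gfun n v s : -1 < s ->
  Cmod (gfun n v s) = exp (- (n * phi s) + Re v * ln (1 + s)).
Proof.
  intros Hs; rewrite gfun_phi, Cmod_mult, Cmod_R, Cmod_rcpow, exp_plus by lra.
  now rewrite Rabs_pos_eq by apply Rlt_le, exp_pos.
Qed.

(* Part [A * phi] of the exponent absorbs the blow-up of [(1+s)^(Re v)] at [s = -1]. *)
Lemma gfun_far_left v A K n s : Rabs (Re v) <= A -> A <= n -> s <= - (1/2) ->
  Cmod (gfun n v s)
  <= exp (2 * A) * 2 ^ S K * (Rabs s ^ S K * exp (- (n * s ^ 2 / 8))).
Proof.
  intros HA Hn Hs; pose proof (Rabs_pos (Re v)).
  assert (Hp : 1 <= 2 ^ S K * Rabs s ^ S K).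
  { apply one_le_pow_double; rewrite Rabs_left1; lra. }
  assert (Hb : Cmod (gfun n v s) <= exp (2 * A) * exp (- (n * s ^ 2 / 8))).
  { rewrite <- exp_plus; destruct (Rlt_le_dec (-1) s) as [Hs1|Hs1].
    - rewrite Cmod_gfun by assumption; apply exp_nondecreasing.
      pose proof (phi_ge_quadratic s) as Hq.
      pose proof (ln_1p_le s Hs1) as Hl.
      assert (H1 : (n - A) * (s ^ 2 / 4) <= (n - A) * phi s)
        by (apply Rmult_le_compat_l; [lra|apply Hq; lra]).
      assert (H2 : (A + Re v) * ln (1 + s) <= 0).
      { apply Rabs_le_between in HA.
        assert (ln (1 + s) <= 0) by lra; nra. }
      (* The last term is nonpositive since [A + Re v >= 0] and [ln (1+s) <= 0]. The others exceed
         [-n s^2/4] by at most [A s^2/4 - A s <= 2 A], hence the factor [exp (2 A)]. *)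
      replace (- (n * phi s) + Re v * ln (1 + s))
        with (- ((n - A) * phi s) + - (A * s) + (A + Re v) * ln (1 + s))
        by (unfold phi; ring).
      assert (H3 : s ^ 2 <= 1) by nra.
      assert (0 <= n * s ^ 2) by nra.
      assert (A * s ^ 2 <= A) by nra.
      assert (- (A * s) <= A) by nra.
      lra.
    - unfold gfun; rewrite rcpow_neg, Cmult_0_r, Cmod_0 by lra.
      apply Rlt_le, exp_pos. }
  eapply Rle_trans; [exact Hb|].
  replace (exp (2 * A) * 2 ^ S K * (Rabs s ^ S K * exp (- (n * s ^ 2 / 8))))
    with (2 ^ S K * Rabs s ^ S K * (exp (2 * A) * exp (- (n * s ^ 2 / 8)))) by ring.
  assert (0 < exp (2 * A) * exp (- (n * s ^ 2 / 8)))
    by (apply Rmult_lt_0_compat; apply exp_pos).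
  nra.
Qed.

(** Here [1 + s <= 3 s], so [(1+s)^(Re v)] is at most [(3 s)^A]. The factor [(2 s)^K >= 1] is
    inserted to raise the power of [s], so that the integral of the bound decays fast enough in
    [n]. *)
Lemma gfun_far_right v A K n s : Rabs (Re v) <= INR A -> 0 <= n -> 1/2 <= s ->
  Cmod (gfun n v s) <= 3 ^ A * 2 ^ K * (Rabs s ^ (A + K) * exp (- (n * Rabs s / 8))).
Proof.
  intros HA Hn Hs; rewrite Rabs_pos_eq by lra.
  rewrite Cmod_gfun, exp_plus by lra.
  assert (H1 : exp (- (n * phi s)) <= exp (- (n * s / 8))).
  { apply exp_nondecreasing; pose proof (phi_ge_linear s Hs); nra. }
  assert (H2 : exp (Re v * ln (1 + s)) <= (3 * s) ^ A).
  { apply Rle_trans with (exp (INR A * ln (3 * s))).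
    - apply exp_nondecreasing.
      assert (0 <= ln (1 + s)) by (rewrite <- ln_1; apply ln_le; lra).
      assert (ln (1 + s) <= ln (3 * s)) by (apply ln_le; lra).
      apply Rabs_le_between in HA; pose proof (pos_INR A); nra.
    - change (Rpower (3 * s) (INR A) <= (3 * s) ^ A).
      rewrite Rpower_pow; lra. }
  pose proof (one_le_pow_double s K Hs) as H3.
  pose proof (exp_pos (- (n * phi s))); pose proof (exp_pos (Re v * ln (1 + s))).
  assert (0 <= (3 * s) ^ A) by (apply pow_le; lra).
  apply Rle_trans with (exp (- (n * s / 8)) * (3 * s) ^ A).
  { apply Rmult_le_compat; lra. }
  rewrite pow_add.
  replace (3 ^ A * 2 ^ K * (s ^ A * s ^ K * exp (- (n * s / 8))))
    with (exp (- (n * s / 8)) * (3 * s) ^ A * (2 ^ K * s ^ K))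
    by (rewrite Rpow_mult_distr; ring).
  assert (0 <= exp (- (n * s / 8)) * (3 * s) ^ A)
    by (apply Rmult_le_pos; [apply Rlt_le, exp_pos|assumption]).
  nra.
Qed.

Lemma gfun_approx v A K : Rabs (Re v) <= INR A ->
  exists B, 0 <= B /\ forall n s, 0 < n -> INR A <= n ->
  Cmod (gfun n v s - RtoC (exp (- (n * s ^ 2 / 2))) * pfun n v K s)
  <= B * (Rabs s ^ S K * exp (- (n * s ^ 2 / 8))
          + Rabs s ^ (A + K) * exp (- (n * Rabs s / 8))).
Proof.
  intros HA.
  destruct (gfun_near v K) as (B1 & HB1 & H1).
  destruct (pfun_far v K) as (B2 & HB2 & H2).
  set (B3 := exp (2 * INR A) * 2 ^ S K); set (B4 := 3 ^ A * 2 ^ K).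
  assert (HB3 : 0 <= B3).
  { apply Rmult_le_pos; [apply Rlt_le, exp_pos|apply pow_le; lra]. }
  assert (HB4 : 0 <= B4) by (apply Rmult_le_pos; apply pow_le; lra).
  exists (B1 + B2 + B3 + B4); split; [lra|]; intros n s Hn HnA.
  set (X := Rabs s ^ S K * exp (- (n * s ^ 2 / 8))).
  set (Y := Rabs s ^ (A + K) * exp (- (n * Rabs s / 8))).
  assert (HX : 0 <= X)
    by (apply Rmult_le_pos; [apply pow_le, Rabs_pos|apply Rlt_le, exp_pos]).
  assert (HY : 0 <= Y)
    by (apply Rmult_le_pos; [apply pow_le, Rabs_pos|apply Rlt_le, exp_pos]).
  destruct (Rle_dec (Rabs s) (1/2)) as [Hs|Hs].
  - specialize (H1 n s Hn Hs); fold X in H1; nra.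
  - assert (Hs' : 1/2 <= Rabs s) by lra.
    specialize (H2 n s Hn Hs'); fold X in H2.
    assert (Hg : Cmod (gfun n v s) <= B3 * X + B4 * Y).
    { destruct (Rle_dec 0 s) as [H0|H0].
      - rewrite Rabs_pos_eq in Hs' by lra.
        pose proof (gfun_far_right v A K n s HA (Rlt_le _ _ Hn) Hs') as L.
        fold Y B4 in L; nra.
      - rewrite Rabs_left in Hs' by lra.
        assert (Hl : s <= - (1/2)) by lra.
        pose proof (gfun_far_left v (INR A) K n s HA HnA Hl) as L.
        fold X B3 in L; nra. }
    unfold Cminus; eapply Rle_trans; [apply Cmod_triangle|].
    rewrite Cmod_opp; nra.
Qed.

(** * Improper integrals *)

Lemma is_RInt_gen_p_infty {V : NormedModule R_AbsRing} (f I : R -> V) a l :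
  Rbar_locally p_infty (fun b => is_RInt f a b (I b)) ->
  filterlim I (Rbar_locally p_infty) (locally l) ->
  is_RInt_gen f (at_point a) (Rbar_locally p_infty) l.
Proof.
  intros Hf HI P HP.
  apply Filter_prod with (fun x => x = a) (fun b => is_RInt f a b (I b) /\ P (I b)).
  - reflexivity.
  - apply filter_and; [exact Hf|exact (HI P HP)].
  - intros x b -> [H1 H2]; exists (I b); split; assumption.
Qed.

Lemma filterlim_RInt_p_infty {V : CompleteNormedModule R_AbsRing} (f : R -> V) a l :
  is_RInt_gen f (at_point a) (Rbar_locally p_infty) l ->
  filterlim (RInt f a) (Rbar_locally p_infty) (locally l).
Proof.
  intros H P HP; destruct (H P HP) as [Q1 Q2 HQ1 HQ2 HQ].
  unfold filtermap; revert HQ2; apply filter_imp; intros b Hb.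
  destruct (HQ a b HQ1 Hb) as (y & Hy & HPy); simpl in Hy.
  now rewrite (is_RInt_unique _ _ _ _ Hy).
Qed.

(** Cauchy criterion in the complete space [V]: increments of the integral of [f] are bounded by
    those of the convergent integral of [g]. *)
Lemma ex_RInt_gen_dominated {V : CompleteNormedModule R_AbsRing}
    (f : R -> V) (g : R -> R) lg :
  (forall a b, ex_RInt f a b) -> (forall a b, ex_RInt g a b) ->
  (forall s, 0 <= s -> norm (f s) <= g s) ->
  is_RInt_gen g (at_point 0) (Rbar_locally p_infty) lg ->
  exists l, is_RInt_gen f (at_point 0) (Rbar_locally p_infty) l.
Proof.
  intros Hf Hg Hfg Hlg; apply (@filterlim_RInt_p_infty R_CompleteNormedModule) in Hlg.
  assert (Hle : forall u v, 0 <= u <= v ->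
            norm (minus (RInt f 0 v) (RInt f 0 u)) <= RInt g 0 v - RInt g 0 u).
  { intros u v Huv.
    assert (E1 : minus (RInt f 0 v) (RInt f 0 u) = RInt f u v).
    { rewrite <- (RInt_Chasles f 0 u v) by auto.
      unfold minus; rewrite (plus_comm (RInt f 0 u)), <- plus_assoc.
      etransitivity; [|apply plus_zero_r].
      apply (f_equal (plus (RInt f u v))); exact (plus_opp_r (RInt f 0 u)). }
    assert (E2 : RInt g 0 v - RInt g 0 u = RInt g u v).
    { rewrite <- (RInt_Chasles g 0 u v) by auto.
      change plus with Rplus; simpl; ring. }
    rewrite E1, E2; apply (norm_RInt_le f g u v); [lra| | |].
    - intros s Hs; apply Hfg; lra.
    - apply (@RInt_correct V), Hf.
    - apply (@RInt_correct R_CompleteNormedModule), Hg. }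
  destruct (proj1 (filterlim_locally_cauchy (F := Rbar_locally p_infty) (RInt f 0)))
    as [l Hl].
  - intros eps.
    exists (fun b => 0 <= b /\ Rabs (RInt g 0 b - lg) < eps / 2); split.
    + apply filter_and; [exists 0; intros; lra|].
      assert (He : 0 < eps / 2) by (destruct eps; simpl; lra).
      apply (Hlg (fun y => Rabs (y - lg) < eps / 2)).
      exists (mkposreal _ He); intros y Hy; exact Hy.
    + intros u v [Hu Bu] [Hv Bv].
      apply Rabs_def2 in Bu; apply Rabs_def2 in Bv.
      destruct (Rle_dec u v).
      * apply (@norm_compat1 R_AbsRing V).
        eapply Rle_lt_trans; [apply (Hle u v); lra|lra].
      * apply ball_sym, (@norm_compat1 R_AbsRing V).
        eapply Rle_lt_trans; [apply (Hle v u); lra|lra].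
  - exists l; apply is_RInt_gen_p_infty with (RInt f 0); [|exact Hl].
    exists 0; intros b _; apply (@RInt_correct V), Hf.
Qed.

(** For a continuous integrand the integral over a shrinking interval at [a] tends to [0], so the
    one-sided limits at [0] in [theta] and [CGamma] can be replaced by ordinary endpoints. *)
Lemma is_RInt_gen_at_right {V : CompleteNormedModule R_AbsRing} (f : R -> V) a
    (Fb : (R -> Prop) -> Prop) {FFb : Filter Fb} l :
  (forall s, continuous f s) ->
  is_RInt_gen f (at_point a) Fb l -> is_RInt_gen f (at_right a) Fb l.
Proof.
  intros Hc H; replace l with (plus (opp zero) l)
    by (rewrite opp_zero; apply plus_zero_l).
  apply (is_RInt_gen_Chasles f a); [|exact H].
  apply is_RInt_gen_swap.
  assert (Hi : forall b, is_RInt f a b (RInt f a b)).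
  { intros b; apply (@RInt_correct V), (@ex_RInt_continuous V); auto. }
  assert (Hl : filterlim (RInt f a) (locally a) (locally (zero : V))).
  { rewrite <- (RInt_point a f).
    apply (ex_derive_continuous (RInt f a) a); exists (f a).
    apply (is_derive_RInt f (RInt f a) a a); [|apply Hc].
    apply filter_forall, Hi. }
  intros P HP.
  apply Filter_prod with (fun x => x = a) (fun b => P (RInt f a b)).
  - reflexivity.
  - apply filter_le_within, Hl, HP.
  - intros x b -> Hb; exists (RInt f a b); split; [apply Hi|exact Hb].
Qed.

(* The upper incomplete Gamma function [int_x^oo t^j e^(-t) dt]. *)
Fixpoint igamma (j : nat) (x : R) : R :=
  match j with
  | O => exp (- x)
  | S i => x ^ S i * exp (- x) + INR (S i) * igamma i x
  end.

Lemma is_derive_igamma j x : is_derive (igamma j) x (- (x ^ j * exp (- x))).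
Proof.
  induction j as [|j IH].
  - simpl; auto_derive; trivial; ring.
  - replace (- (x ^ S j * exp (- x)))
      with ((INR (S j) * x ^ j * exp (- x) - x ^ S j * exp (- x))
            + INR (S j) * (- (x ^ j * exp (- x)))) by ring.
    apply (is_derive_plus (fun x => x ^ S j * exp (- x))
             (fun x => INR (S j) * igamma j x)).
    + auto_derive; trivial; simpl; ring.
    + apply (is_derive_scal (igamma j)), IH.
Qed.

Lemma igamma_0 j : igamma j 0 = INR (fact j).
Proof.
  induction j as [|j IH]; [simpl; now rewrite Ropp_0, exp_0|].
  cbn [igamma]; rewrite IH, pow_i, fact_simpl, mult_INR by lia; ring.
Qed.

Lemma igamma_bound j : exists C, forall x, 0 <= x ->
  0 <= igamma j x <= C * exp (- (x / 2)).
Proof.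
  induction j as [|j (C & IH)].
  - exists 1; intros x Hx; simpl; split; [apply Rlt_le, exp_pos|].
    rewrite Rmult_1_l; apply exp_nondecreasing; lra.
  - exists (8 ^ S j * INR (fact (S j)) + INR (S j) * C); intros x Hx.
    destruct (IH x Hx) as [H1 H2]; cbn [igamma].
    pose proof (pos_INR (S j)); pose proof (exp_pos (- x)).
    assert (0 <= x ^ S j) by (apply pow_le; lra).
    split; [apply Rplus_le_le_0_compat; apply Rmult_le_pos; lra|].
    rewrite Rmult_plus_distr_r; apply Rplus_le_compat.
    + eapply Rle_trans; [apply Rmult_le_compat_r; [lra|apply pow_le_exp, Hx]|].
      rewrite Rmult_assoc; apply Rmult_le_compat_l.
      * apply Rmult_le_pos; [apply pow_le; lra|apply pos_INR].
      * rewrite <- exp_plus; apply exp_nondecreasing; lra.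
    + rewrite Rmult_assoc; apply Rmult_le_compat_l; lra.
Qed.

Lemma is_lim_igamma j : is_lim (igamma j) p_infty 0.
Proof.
  destruct (igamma_bound j) as (C & HC).
  apply is_lim_le_le_loc with (fun _ => 0) (fun x => C * exp (- (x / 2))).
  - exists 0; intros x Hx; apply HC; lra.
  - apply is_lim_const.
  - replace (Finite 0) with (Rbar_mult C 0) by (simpl; f_equal; ring).
    apply is_lim_scal_l.
    apply is_lim_comp with m_infty; [apply is_lim_exp_m| |].
    + apply is_lim_spec; intros M; exists (2 * Rabs M); intros x Hx.
      pose proof (Rabs_maj2 M); lra.
    + exists 0; intros; discriminate.
Qed.

(* [F] is the substituted variable: [int F^j e^(-F) F' = j!] when [F] runs
   from [0] to [+oo]. *)
Lemma is_RInt_gen_gamma_subst j (F dF : R -> R) :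
  F 0 = 0 -> is_lim F p_infty p_infty ->
  (forall s, is_derive F s (dF s)) -> (forall s, continuous dF s) ->
  is_RInt_gen (fun s => dF s * (F s ^ j * exp (- F s)))
    (at_point 0) (Rbar_locally p_infty) (INR (fact j)).
Proof.
  intros F0 Flim HF HdF.
  apply is_RInt_gen_p_infty with (fun b => INR (fact j) - igamma j (F b)).
  - exists 0; intros b _.
    replace (INR (fact j) - igamma j (F b))
      with (minus ((fun s => - igamma j (F s)) b) ((fun s => - igamma j (F s)) 0)).
    + apply (is_RInt_derive (fun s => - igamma j (F s))).
      * intros s _.
        replace (dF s * (F s ^ j * exp (- F s)))
          with (- (dF s * - (F s ^ j * exp (- F s)))) by ring.
        apply (is_derive_opp (fun s => igamma j (F s))).
        apply (is_derive_comp (igamma j) F); [apply is_derive_igamma|apply HF].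
      * intros s _; apply (continuous_mult dF (fun s => F s ^ j * exp (- F s)));
          [apply HdF|].
        apply (continuous_comp F (fun x => x ^ j * exp (- x))).
        -- apply (ex_derive_continuous F); exists (dF s); apply HF.
        -- apply (ex_derive_continuous (fun x => x ^ j * exp (- x))).
           auto_derive; trivial.
    + unfold minus, plus, opp; simpl; rewrite F0, igamma_0; ring.
  - assert (L : is_lim (fun b => INR (fact j) - igamma j (F b)) p_infty
                  (INR (fact j) - 0)).
    { apply (is_lim_minus' (fun _ => INR (fact j)) (fun b => igamma j (F b)));
        [apply is_lim_const|].
      apply is_lim_comp with p_infty; [apply is_lim_igamma|exact Flim|].
      exists 0; intros; discriminate. }
    rewrite Rminus_0_r in L; exact L.
Qed.

Lemma is_RInt_gen_pow_exp j a : 0 < a ->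
  is_RInt_gen (fun s => s ^ j * exp (- (a * s))) (at_point 0)
    (Rbar_locally p_infty) (INR (fact j) / a ^ S j).
Proof.
  intros Ha; assert (Hp : a ^ S j <> 0) by (apply pow_nonzero; lra).
  replace (INR (fact j) / a ^ S j) with (scal (/ a ^ S j) (INR (fact j)))
    by (unfold scal; simpl; unfold mult; simpl; field; split; [|lra];
        apply pow_nonzero; lra).
  apply is_RInt_gen_ext with
    (fun s => scal (/ a ^ S j) (a * ((a * s) ^ j * exp (- (a * s))))).
  { apply filter_forall; intros ab s _.
    unfold scal; simpl; unfold mult; simpl; rewrite Rpow_mult_distr; field.
    split; [|lra]; apply pow_nonzero; lra. }
  apply (is_RInt_gen_scal (fun s => a * ((a * s) ^ j * exp (- (a * s))))).
  apply (is_RInt_gen_gamma_subst j (fun s => a * s) (fun _ => a)).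
  - ring.
  - apply is_lim_spec; intros M; exists (Rabs M / a); intros s Hs.
    apply Rlt_div_l in Hs; [|lra]; pose proof (Rle_abs M); lra.
  - intros s; auto_derive; trivial; ring.
  - intros s; apply continuous_const.
Qed.

(** With [F = n s^2/2], [s^(2j+1) ds] becomes [2^j F^j dF / n^(j+1)]: odd powers lead to integer
    factorials. *)
Lemma is_RInt_gen_odd_gauss j n : 0 < n ->
  is_RInt_gen (fun s => s ^ (2 * j + 1) * exp (- (n * s ^ 2 / 2))) (at_point 0)
    (Rbar_locally p_infty) (2 ^ j * INR (fact j) / n ^ S j).
Proof.
  intros Hn; assert (Hp : n ^ j <> 0) by (apply pow_nonzero; lra).
  replace (2 ^ j * INR (fact j) / n ^ S j)
    with (scal (2 ^ j / n ^ S j) (INR (fact j)))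
    by (unfold scal; simpl; unfold mult; simpl; field; split; [assumption|lra]).
  apply is_RInt_gen_ext with (fun s => scal (2 ^ j / n ^ S j)
    (n * s * ((n * s ^ 2 / 2) ^ j * exp (- (n * s ^ 2 / 2))))).
  { apply filter_forall; intros ab s _.
    change (2 ^ j / n ^ S j * (n * s * ((n * s ^ 2 / 2) ^ j * exp (- (n * s ^ 2 / 2))))
      = s ^ (2 * j + 1) * exp (- (n * s ^ 2 / 2))).
    rewrite pow_add, (pow_mult s), <- tech_pow_Rmult.
    replace ((n * s ^ 2 / 2) ^ j) with (n ^ j * (s ^ 2) ^ j / 2 ^ j)
      by (unfold Rdiv; rewrite !Rpow_mult_distr, pow_inv; reflexivity).
    field; repeat split; try apply pow_nonzero; lra. }
  apply (is_RInt_gen_scal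
    (fun s => n * s * ((n * s ^ 2 / 2) ^ j * exp (- (n * s ^ 2 / 2))))).
  apply (is_RInt_gen_gamma_subst j (fun s => n * s ^ 2 / 2) (fun s => n * s)).
  - field.
  - apply is_lim_spec; intros M; exists (Rmax 1 (2 * Rabs M / n)); intros s Hs.
    assert (H1 : 1 < s) by (eapply Rle_lt_trans; [apply Rmax_l|exact Hs]).
    assert (H2 : 2 * Rabs M / n < s) by (eapply Rle_lt_trans; [apply Rmax_r|exact Hs]).
    apply Rlt_div_l in H2; [|lra]; pose proof (Rle_abs M).
    assert (0 < (s - 1) * (s * n))
      by (apply Rmult_lt_0_compat; [lra|apply Rmult_lt_0_compat; lra]).
    replace (s ^ 2) with (s * s) by ring; lra.
  - intros s; auto_derive; trivial; field.
  - intros s; apply (ex_derive_continuous (fun s => n * s)); auto_derive; trivial.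
Qed.

(** * Complex-valued integrals and [theta] *)

(** Integration lemmas leave equations typed in the carrier of a module; [ring] and [field] expect
    the type [Cx]. *)
Ltac as_complex_eq :=
  match goal with |- @eq _ ?x ?y => change (@eq Cx x y) end.

Lemma norm_C_R (z : Cx) : norm (V := C_R_NormedModule) z = Cmod z.
Proof.
  unfold Cmod; change (norm (V := C_R_NormedModule) z)
    with (sqrt (Rabs (fst z) ^ 2 + Rabs (snd z) ^ 2)).
  now rewrite !pow2_abs.
Qed.

Lemma scal_C_R (u : R) (z : Cx) : scal (V := C_R_NormedModule) u z = (RtoC u * z)%C.
Proof.
  destruct z as [x y]; apply injective_projections; simpl;
    unfold scal; simpl; unfold mult; simpl; ring.
Qed.

Definition ccontinuous (f : R -> Cx) (s : R) : Prop :=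
  continuous (fun t => Re (f t)) s /\ continuous (fun t => Im (f t)) s.

Lemma ccontinuous_continuous f s :
  ccontinuous f s -> continuous (U := C_R_CompleteNormedModule) f s.
Proof.
  intros [H1 H2]; apply filterlim_locally; intros eps.
  pose proof (proj1 (filterlim_locally _ _) H1 eps) as K1.
  pose proof (proj1 (filterlim_locally _ _) H2 eps) as K2.
  generalize (filter_and _ _ K1 K2); apply filter_imp; intros t [A1 A2].
  split; assumption.
Qed.

Lemma ccontinuous_const c s : ccontinuous (fun _ => c) s.
Proof. split; apply continuous_const. Qed.

Lemma ccontinuous_RtoC (q : R -> R) s :
  continuous q s -> ccontinuous (fun t => RtoC (q t)) s.
Proof. intros H; split; [exact H|apply continuous_const]. Qed.

Lemma ccontinuous_plus f g s :
  ccontinuous f s -> ccontinuous g s -> ccontinuous (fun t => (f t + g t)%C) s.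
Proof.
  intros [F1 F2] [G1 G2]; split.
  - apply (continuous_plus (fun t => Re (f t)) (fun t => Re (g t))); assumption.
  - apply (continuous_plus (fun t => Im (f t)) (fun t => Im (g t))); assumption.
Qed.

Lemma ccontinuous_opp f s :
  ccontinuous f s -> ccontinuous (fun t => (- f t)%C) s.
Proof.
  intros [F1 F2]; split.
  - apply (continuous_opp (fun t => Re (f t))); assumption.
  - apply (continuous_opp (fun t => Im (f t))); assumption.
Qed.

Lemma ccontinuous_mult f g s :
  ccontinuous f s -> ccontinuous g s -> ccontinuous (fun t => (f t * g t)%C) s.
Proof.
  intros [F1 F2] [G1 G2]; split.
  - apply (continuous_minus (fun t => Re (f t) * Re (g t))
             (fun t => Im (f t) * Im (g t))).
    + apply (continuous_mult (fun t => Re (f t)) (fun t => Re (g t))); assumption.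
    + apply (continuous_mult (fun t => Im (f t)) (fun t => Im (g t))); assumption.
  - apply (continuous_plus (fun t => Re (f t) * Im (g t))
             (fun t => Im (f t) * Re (g t))).
    + apply (continuous_mult (fun t => Re (f t)) (fun t => Im (g t))); assumption.
    + apply (continuous_mult (fun t => Im (f t)) (fun t => Re (g t))); assumption.
Qed.

Lemma ccontinuous_csum K (f : nat -> R -> Cx) s :
  (forall k, ccontinuous (f k) s) -> ccontinuous (fun t => csum K (fun k => f k t)) s.
Proof.
  intros H; induction K as [|K IH]; simpl; [apply H|].
  apply ccontinuous_plus; [exact IH|apply H].
Qed.

Lemma ccontinuous_lin f a b s :
  ccontinuous f (a * s + b) -> ccontinuous (fun t => f (a * t + b)) s.
Proof.
  assert (Hl : continuous (fun t => a * t + b) s).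
  { apply (ex_derive_continuous (fun t => a * t + b)); auto_derive; trivial. }
  intros [H1 H2]; split.
  - apply (continuous_comp (fun t => a * t + b) (fun x => Re (f x))); assumption.
  - apply (continuous_comp (fun t => a * t + b) (fun x => Im (f x))); assumption.
Qed.

Lemma ccontinuous_of_bound f s :
  f s = RtoC 0 -> (forall t, Rabs (t - s) < 1 -> Cmod (f t) <= Rabs (t - s)) ->
  ccontinuous f s.
Proof.
  intros H0 H.
  assert (G : forall h : Cx -> R, h (RtoC 0) = 0 -> (forall z, Rabs (h z) <= Cmod z) ->
            continuous (fun t => h (f t)) s).
  { intros h h0 Hh; apply filterlim_locally; intros eps.
    assert (He : 0 < Rmin 1 eps) by (apply Rmin_pos; [lra|apply cond_pos]).
    exists (mkposreal _ He); intros t Ht.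
    assert (Ht' : Rabs (t - s) < Rmin 1 eps) by exact Ht.
    change (Rabs (h (f t) - h (f s)) < eps).
    rewrite H0, h0, Rminus_0_r.
    eapply Rle_lt_trans; [apply Hh|].
    eapply Rle_lt_trans; [apply H|]; eapply Rlt_le_trans; try exact Ht';
      [apply Rmin_l|apply Rmin_r]. }
  split; apply G; auto using re_le_Cmod, im_le_Cmod.
Qed.

(** The delicate point is [-1], where the power meets its default value [0]. For [Re w >= 1],
    [|(1+t)^w| <= 1 + t] just to the right of it, so the pieces join continuously. *)
Lemma ccontinuous_rcpow w s : 1 <= Re w -> ccontinuous (fun t => rcpow (1 + t) w) s.
Proof.
  intros Hw; destruct (Rlt_le_dec (-1) s) as [Hs|Hs].
  - destruct (is_cderive_rcpow w s Hs) as [D1 D2]; split.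
    + apply (ex_derive_continuous (fun t => Re (rcpow (1 + t) w)));
        eexists; exact D1.
    + apply (ex_derive_continuous (fun t => Im (rcpow (1 + t) w)));
        eexists; exact D2.
  - apply ccontinuous_of_bound; [apply rcpow_neg; lra|].
    intros t Ht; destruct (Rlt_le_dec (-1) t) as [H|H].
    + rewrite Cmod_rcpow by lra.
      rewrite Rabs_pos_eq in * by lra.
      apply Rle_trans with (exp (ln (1 + t))); [|rewrite exp_ln; lra].
      apply exp_nondecreasing.
      assert (ln (1 + t) <= 0) by (rewrite <- ln_1; apply ln_le; lra); nra.
    + rewrite rcpow_neg, Cmod_0 by lra; apply Rabs_pos.
Qed.

Lemma ccontinuous_gfun n v s :
  1 <= Re (RtoC n + v)%C -> ccontinuous (gfun n v) s.
Proof.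
  intros H; apply ccontinuous_mult; [|apply ccontinuous_rcpow, H].
  apply ccontinuous_RtoC, (ex_derive_continuous (fun t => exp (- (n * t)))).
  auto_derive; trivial.
Qed.

(** The module structure used for integration has real scalars only, so complex factors are handled
    by components. *)
Lemma is_RInt_Cmult c (f : R -> Cx) a b (l : Cx) :
  is_RInt (V := C_R_NormedModule) f a b l ->
  is_RInt (V := C_R_NormedModule) (fun t => (c * f t)%C) a b (c * l)%C.
Proof.
  intros H.
  pose proof (is_RInt_fct_extend_fst (U := R_NormedModule) (V := R_NormedModule)
    f a b l H) as H1.
  pose proof (is_RInt_fct_extend_snd (U := R_NormedModule) (V := R_NormedModule)
    f a b l H) as H2.
  apply (is_RInt_fct_extend_pair (U := R_NormedModule) (V := R_NormedModule)
    (fun t => (c * f t)%C)).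
  - apply (is_RInt_minus (fun t => fst c * fst (f t)) (fun t => snd c * snd (f t)));
      [apply (is_RInt_scal (fun t => fst (f t)))|
       apply (is_RInt_scal (fun t => snd (f t)))]; assumption.
  - apply (is_RInt_plus (fun t => fst c * snd (f t)) (fun t => snd c * fst (f t)));
      [apply (is_RInt_scal (fun t => snd (f t)))|
       apply (is_RInt_scal (fun t => fst (f t)))]; assumption.
Qed.

Lemma is_RInt_RtoC (q : R -> R) a b l :
  is_RInt q a b l ->
  is_RInt (V := C_R_NormedModule) (fun t => RtoC (q t)) a b (RtoC l).
Proof.
  intros H; apply (is_RInt_fct_extend_pair (U := R_NormedModule)
    (V := R_NormedModule) (fun t => RtoC (q t))); [exact H|].
  replace 0 with (scal (b - a) 0)
    by (unfold scal; simpl; unfold mult; simpl; ring).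
  apply (is_RInt_const a b 0).
Qed.

Lemma is_RInt_gen_Cmult_RtoC c (q : R -> R) (Fa Fb : (R -> Prop) -> Prop)
    {FFa : Filter Fa} {FFb : Filter Fb} l :
  is_RInt_gen q Fa Fb l ->
  is_RInt_gen (V := C_R_NormedModule) (fun t => (c * RtoC (q t))%C) Fa Fb
    (c * RtoC l)%C.
Proof.
  intros H P HP.
  assert (HC : continuous (U := C_R_CompleteNormedModule) (fun x => c * RtoC x)%C l).
  { apply ccontinuous_continuous, ccontinuous_mult; [apply ccontinuous_const|].
    apply ccontinuous_RtoC, continuous_id. }
  specialize (H _ (HC P HP)); unfold filtermapi in *; revert H.
  apply filter_imp; intros ab (y & Hy & HPy); exists (c * RtoC y)%C.
  split; [apply is_RInt_Cmult, is_RInt_RtoC, Hy|exact HPy].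
Qed.

Lemma is_RInt_gen_csum K (f : nat -> R -> Cx) (l : nat -> Cx)
    (Fa Fb : (R -> Prop) -> Prop) {FFa : Filter Fa} {FFb : Filter Fb} :
  (forall k, is_RInt_gen (V := C_R_NormedModule) (f k) Fa Fb (l k)) ->
  is_RInt_gen (V := C_R_NormedModule) (fun t => csum K (fun k => f k t)) Fa Fb
    (csum K l).
Proof.
  intros H; induction K as [|K IH]; simpl; [apply H|].
  apply (is_RInt_gen_plus (V := C_R_NormedModule)
    (fun t => csum K (fun k => f k t)) (f (S K))); [exact IH|apply H].
Qed.

(** * From [theta] to the integrals of [gfun] *)

Lemma is_RInt_gfun n v a b : 1 <= Re (RtoC n + v)%C ->
  is_RInt (V := C_R_NormedModule) (gfun n v) a b
    (RInt (V := C_R_CompleteNormedModule) (gfun n v) a b).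
Proof.
  intros H; apply (@RInt_correct C_R_CompleteNormedModule).
  apply (@ex_RInt_continuous C_R_CompleteNormedModule); intros z _.
  apply ccontinuous_continuous, ccontinuous_gfun, H.
Qed.

Lemma is_RInt_gen_gfun_opp n v (Lm : Cx) :
  is_RInt (V := C_R_NormedModule) (gfun n v) (-1) 0 Lm ->
  is_RInt_gen (V := C_R_NormedModule) (fun s => gfun n v (- s))
    (at_point 0) (Rbar_locally p_infty) Lm.
Proof.
  intros H; apply is_RInt_gen_p_infty with (fun _ => Lm); [|apply filterlim_const].
  (* Beyond [1] the reflected integrand is zero, so its integral is constant in the upper
     endpoint. *)
  exists 1; intros b Hb.
  replace Lm with (Lm + RtoC 0)%C by apply Cplus_0_r.
  apply (is_RInt_Chasles (V := C_R_NormedModule) _ 0 1 b Lm (RtoC 0)).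
  - apply (is_RInt_swap (V := C_R_NormedModule)) in H.
    replace (-1) with (-1 * 1 + 0) in H by ring.
    replace 0 with (-1 * 0 + 0) in H at 1 by ring.
    apply (is_RInt_comp_lin (V := C_R_NormedModule)) in H.
    apply (is_RInt_opp (V := C_R_NormedModule)) in H.
    rewrite opp_opp in H; revert H; apply is_RInt_ext; intros s _.
    rewrite scal_C_R; replace (-1 * s + 0) with (- s) by ring.
    change (- (RtoC (-1) * gfun n v (- s)) = gfun n v (- s))%C.
    rewrite RtoC_m1; ring.
  - apply (is_RInt_ext (V := C_R_NormedModule)) with (fun _ => RtoC 0).
    + intros s Hs; rewrite Rmin_left in Hs by lra.
      unfold gfun; rewrite rcpow_neg by lra; symmetry; apply Cmult_0_r.
    + pose proof (is_RInt_const (V := C_R_NormedModule) 1 b (RtoC 0)) as H0.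
      rewrite scal_C_R, Cmult_0_r in H0; exact H0.
Qed.

(** The Gamma term equals [(n/2) (Lm + Lp)]; subtracting it from [n Lm] leaves half the difference
    of the two sides. *)
Lemma theta_gfun n v (Lm Lp : Cx) : 0 < n -> 1 <= Re (RtoC n + v)%C ->
  is_RInt (V := C_R_NormedModule) (gfun n v) (-1) 0 Lm ->
  is_RInt_gen (V := C_R_NormedModule) (gfun n v)
    (at_point 0) (Rbar_locally p_infty) Lp ->
  theta n v = (RtoC 1 - RtoC (n / 2) * (Lp - Lm))%C.
Proof.
  intros Hn Hw HLm HLp.
  assert (Hlow : RInt_gen (V := C_R_CompleteNormedModule)
     (fun z => (RtoC (exp (n * (1 - z))) * rcpow z (RtoC n + v))%C)
     (at_right 0) (at_point 1) = Lm).
  { assert (E : forall z, gfun n v (1 * z + -1)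
                = (RtoC (exp (n * (1 - z))) * rcpow z (RtoC n + v))%C).
    { intros z; unfold gfun; f_equal; f_equal; f_equal; ring. }
    apply (is_RInt_gen_unique (V := C_R_CompleteNormedModule)).
    apply (is_RInt_gen_at_right (V := C_R_CompleteNormedModule) _ 0 (at_point 1)).
    - intros z; apply continuous_ext with (fun z => gfun n v (1 * z + -1)); [exact E|].
      apply ccontinuous_continuous, ccontinuous_lin, ccontinuous_gfun, Hw.
    - apply (is_RInt_gen_at_point (V := C_R_NormedModule)).
      replace (-1) with (1 * 0 + -1) in HLm by ring.
      replace 0 with (1 * 1 + -1) in HLm at 2 by ring.
      apply (is_RInt_comp_lin (V := C_R_NormedModule)) in HLm.
      revert HLm; apply is_RInt_ext; intros z _.
      rewrite scal_C_R, <- E; as_complex_eq; ring. }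
  set (c := (RtoC (exp (- n)) * rcpow n (RtoC n + v))%C).
  assert (Hgam : CGamma (RtoC n + v + RtoC 1)%C = (RtoC n * c * (Lm + Lp))%C).
  { assert (E : forall t, (c * gfun n v (/ n * t + -1))%C
       = (rcpow t (RtoC n + v + RtoC 1 - RtoC 1) * RtoC (exp (- t)))%C).
    { intros t; replace (RtoC n + v + RtoC 1 - RtoC 1)%C with (RtoC n + v)%C by ring.
      unfold c, gfun; replace (1 + (/ n * t + -1)) with (/ n * t) by ring.
      destruct (Rlt_le_dec 0 t) as [Ht|Ht].
      - assert (Hnt : 0 < / n * t)
          by (apply Rmult_lt_0_compat; [apply Rinv_0_lt_compat; lra|lra]).
        assert (Ep : rcpow t (RtoC n + v)
                 = (rcpow n (RtoC n + v) * rcpow (/ n * t) (RtoC n + v))%C).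
        { rewrite !(rcpow_pos _ _ Hn), !(rcpow_pos _ _ Hnt), !(rcpow_pos _ _ Ht).
          replace (ln t) with (ln n + ln (/ n * t))
            by (rewrite <- ln_mult by lra; f_equal; field; lra).
          rewrite !Rmult_plus_distr_l, exp_plus, cos_plus, sin_plus.
          apply injective_projections; simpl; ring. }
        rewrite Ep; replace (- t) with (- n + - (n * (/ n * t + -1))) by (field; lra).
        rewrite exp_plus, RtoC_mult; ring.
      - assert (Hi : 0 < / n) by (apply Rinv_0_lt_compat; lra).
        rewrite (rcpow_neg t), (rcpow_neg (/ n * t)) by nra; ring. }
    unfold CGamma; apply (is_RInt_gen_unique (V := C_R_CompleteNormedModule)).
    apply (is_RInt_gen_at_right (V := C_R_CompleteNormedModule) _ 0
      (Rbar_locally p_infty)).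
    { intros t; apply continuous_ext with (fun t => (c * gfun n v (/ n * t + -1))%C);
        [exact E|].
      apply ccontinuous_continuous, ccontinuous_mult; [apply ccontinuous_const|].
      apply ccontinuous_lin, ccontinuous_gfun, Hw. }
    set (G := RInt (V := C_R_CompleteNormedModule) (gfun n v) 0).
    apply is_RInt_gen_p_infty with
      (fun b => (RtoC n * c * (Lm + G (/ n * b + -1)%R))%C).
    - exists 0; intros b _.
      assert (H : is_RInt (V := C_R_NormedModule) (gfun n v) (/ n * 0 + -1)
                    (/ n * b + -1) (Lm + G (/ n * b + -1)%R)%C).
      { rewrite Rmult_0_r, Rplus_0_l.
        apply (is_RInt_Chasles (V := C_R_NormedModule)) with 0; [exact HLm|].
        apply is_RInt_gfun, Hw. }
      apply (is_RInt_comp_lin (V := C_R_NormedModule)) in H.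
      apply (is_RInt_Cmult (RtoC n * c)) in H.
      revert H; apply is_RInt_ext; intros t _.
      rewrite scal_C_R, <- E, RtoC_inv by lra.
      as_complex_eq; field; injection; lra.
    - apply filterlim_comp with (f := fun b => / n * b + -1)
        (G := Rbar_locally p_infty)
        (g := fun x => (RtoC n * c * (Lm + G x))%C).
      + change (is_lim (fun b => / n * b + -1) p_infty p_infty).
        apply is_lim_spec; intros M; exists (n * (M + 1)); intros b Hb.
        assert (M + 1 < / n * b); [|lra].
        apply Rmult_lt_reg_l with n; [lra|].
        rewrite <- Rmult_assoc, Rinv_r; lra.
      + apply filterlim_comp with (f := G)
          (G := locally (T := C_R_CompleteNormedModule) Lp)
          (g := fun y => (RtoC n * c * (Lm + y))%C).
        * apply (filterlim_RInt_p_infty (V := C_R_CompleteNormedModule)), HLp.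
        (* Continuity is proved in the complex module, where multiplication by a complex constant is
           scalar multiplication; the neighbourhoods are those of the real module. *)
        * assert (HC : forall y0 : Cx, filterlim (fun y => (RtoC n * c * (Lm + y))%C)
            (locally (T := C_R_CompleteNormedModule) y0)
            (locally (T := C_R_CompleteNormedModule) (RtoC n * c * (Lm + y0))%C)).
          { intros y0.
            apply (continuous_scal_r (K := C_AbsRing) (V := C_NormedModule)
              (RtoC n * c)%C (fun y : C_UniformSpace => plus (G := C_NormedModule) Lm y)).
            apply (continuous_plus (V := C_NormedModule)
              (fun _ : C_UniformSpace => Lm) (fun y => y));
              [apply continuous_const|apply continuous_id]. }
          apply HC. }
  unfold theta; rewrite Hlow, Hgam; unfold c.
  assert (H1 : rcpow n (RtoC n + v) <> RtoC 0).
  { intros K; apply (f_equal Cmod) in K.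
    rewrite Cmod_rcpow, Cmod_0 in K by lra.
    pose proof (exp_pos (Re (RtoC n + v) * ln n)); lra. }
  assert (H2 : (RtoC (exp n) * RtoC (exp (- n)))%C = RtoC 1).
  { rewrite <- RtoC_mult, <- exp_plus, Rplus_opp_r, exp_0; reflexivity. }
  rewrite RtoC_div by lra.
  transitivity (RtoC 1 + (RtoC n * Lm
    - RtoC n * (RtoC (exp n) * RtoC (exp (- n))) * (Lm + Lp) / RtoC 2))%C.
  - field; exact H1.
  - rewrite H2; field; injection; lra.
Qed.

(** * The asymptotic expansion *)

(** Two coefficients are peeled off per step: the even one cancels and the odd one doubles. Degree
    [2 R' + 2] contains exactly the odd exponents [2 r + 1] with [r <= R']. *)
Lemma horner_odd_part R' c s :
  (horner (S (2 * R' + 2)) c s - horner (S (2 * R' + 2)) c (- s)%R)%C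
  = csum R' (fun r => (RtoC 2 * c (2 * r + 1)%nat * RtoC (s ^ (2 * r + 1)))%C).
Proof.
  revert c; induction R' as [|R' IH]; intros c.
  - simpl; rewrite RtoC_opp, Rmult_1_r; ring.
  - replace (S (2 * S R' + 2)) with (S (S (S (2 * R' + 2)))) by lia.
    rewrite csum_S_l.
    transitivity (RtoC 2 * c 1%nat * RtoC s
      + RtoC (s ^ 2) * (horner (S (2 * R' + 2)) (fun p => c (S (S p))) s
                        - horner (S (2 * R' + 2)) (fun p => c (S (S p))) (- s)%R))%C.
    + set (H := horner (S (2 * R' + 2)) (fun p => c (S (S p)))).
      change (c O + RtoC s * (c 1%nat + RtoC s * H s)
              - (c O + RtoC (- s) * (c 1%nat + RtoC (- s) * H (- s)%R))
              = RtoC 2 * c 1%nat * RtoC s + RtoC (s ^ 2) * (H s - H (- s)%R))%C.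
      replace (s ^ 2) with (s * s) by ring.
      rewrite RtoC_opp, RtoC_mult; ring.
    + rewrite IH, <- csum_scal; f_equal.
      * simpl; rewrite Rmult_1_r; reflexivity.
      * apply csum_ext; intros i _.
        replace (2 * S i + 1)%nat with (S (S (2 * i + 1))) by lia.
        replace (s ^ S (S (2 * i + 1))) with (s ^ 2 * s ^ (2 * i + 1))
          by (rewrite <- pow_add; reflexivity).
        rewrite RtoC_mult; cbv beta; ring.
Qed.

(** The [2] comes from the odd part, [(-n)^k/k!] from the exponential series; the [s^(2k)]
    accompanying [h^k] is moved into the power of [s] in [wfun]. *)
Definition wcoef (n : R) (v : Cx) (k r : nat) : Cx :=
  (RtoC (2 * (- n) ^ k / INR (fact k)) * ccoef v k (2 * r + 1)%nat)%C.

Definition wfun (n : R) (v : Cx) (R' : nat) (s : R) : Cx :=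
  csum (2 * R' + 2) (fun k => csum R' (fun r =>
    (wcoef n v k r * RtoC (s ^ (2 * (k + r) + 1) * exp (- (n * s ^ 2 / 2))))%C)).

Lemma pfun_odd_part n v R' s :
  (RtoC (exp (- (n * s ^ 2 / 2))) * pfun n v (2 * R' + 2) s
   - RtoC (exp (- (n * (- s) ^ 2 / 2))) * pfun n v (2 * R' + 2) (- s)%R)%C
  = wfun n v R' s.
Proof.
  unfold pfun, wfun; replace ((- s) ^ 2) with (s ^ 2) by ring.
  rewrite <- !csum_scal, <- csum_minus.
  apply csum_ext; intros k _.
  transitivity (RtoC (exp (- (n * s ^ 2 / 2)))
    * RtoC ((- (n * s ^ 2)) ^ k / INR (fact k))
    * (horner (S (2 * R' + 2)) (ccoef v k) s
       - horner (S (2 * R' + 2)) (ccoef v k) (- s)%R))%C; [ring|].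
  rewrite horner_odd_part, <- csum_scal; apply csum_ext; intros r _.
  unfold wcoef.
  replace (s ^ (2 * (k + r) + 1)) with ((s ^ 2) ^ k * s ^ (2 * r + 1))
    by (rewrite <- pow_mult, <- pow_add; f_equal; lia).
  replace (- (n * s ^ 2)) with (- n * s ^ 2) by ring.
  rewrite Rpow_mult_distr.
  replace ((- n) ^ k * (s ^ 2) ^ k / INR (fact k))
    with ((- n) ^ k / INR (fact k) * (s ^ 2) ^ k) by (unfold Rdiv; ring).
  replace (2 * (- n) ^ k / INR (fact k)) with (2 * ((- n) ^ k / INR (fact k)))
    by (unfold Rdiv; ring).
  rewrite !RtoC_mult; ring.
Qed.

Definition wint (n : R) (v : Cx) (R' : nat) : Cx :=
  csum (2 * R' + 2) (fun k => csum R' (fun r =>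
    (wcoef n v k r * RtoC (2 ^ (k + r) * INR (fact (k + r)) / n ^ S (k + r)))%C)).

Lemma is_RInt_gen_wfun n v R' : 0 < n ->
  is_RInt_gen (V := C_R_NormedModule) (wfun n v R') (at_point 0)
    (Rbar_locally p_infty) (wint n v R').
Proof.
  intros Hn.
  apply (is_RInt_gen_csum _ (fun k s => csum R' (fun r => (wcoef n v k r
      * RtoC (s ^ (2 * (k + r) + 1) * exp (- (n * s ^ 2 / 2))))%C)) _
    (at_point 0) (Rbar_locally p_infty)); intros k.
  apply (is_RInt_gen_csum R' (fun r s => (wcoef n v k r
      * RtoC (s ^ (2 * (k + r) + 1) * exp (- (n * s ^ 2 / 2))))%C) _
    (at_point 0) (Rbar_locally p_infty)); intros r.
  apply (is_RInt_gen_Cmult_RtoC _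
    (fun s => s ^ (2 * (k + r) + 1) * exp (- (n * s ^ 2 / 2)))
    (at_point 0) (Rbar_locally p_infty)).
  apply is_RInt_gen_odd_gauss, Hn.
Qed.

Lemma ccontinuous_wfun n v R' s : ccontinuous (wfun n v R') s.
Proof.
  apply ccontinuous_csum; intros k.
  apply (ccontinuous_csum R' (fun r s => (wcoef n v k r
    * RtoC (s ^ (2 * (k + r) + 1) * exp (- (n * s ^ 2 / 2))))%C)); intros r.
  apply ccontinuous_mult; [apply ccontinuous_const|].
  apply ccontinuous_RtoC.
  apply (ex_derive_continuous
    (fun s => s ^ (2 * (k + r) + 1) * exp (- (n * s ^ 2 / 2)))).
  auto_derive; trivial.
Qed.

(** * Identification of the coefficients with [rho] *)

Lemma dfact_even q : dfact (2 * q) = (2 ^ q * fact q)%nat.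
Proof.
  induction q as [|q IH]; [reflexivity|].
  replace (2 * S q)%nat with (S (S (2 * q))) by lia.
  change (dfact (S (S (2 * q)))) with (S (S (2 * q)) * dfact (2 * q))%nat.
  rewrite IH, fact_simpl; simpl Nat.pow; lia.
Qed.

Lemma deMoivre_gt a k n : (n < k)%nat -> deMoivre a k n = 0.
Proof.
  revert n; induction k as [|k IH]; intros n H; [lia|].
  cbn [deMoivre]; apply sum_eq_R0; intros j Hj.
  destruct j as [|j]; [reflexivity|]; simpl Nat.eqb; cbv iota.
  rewrite IH by lia; ring.
Qed.

Lemma csum_extend m K f : (m <= K)%nat ->
  (forall k, (m < k)%nat -> f k = RtoC 0) -> csum K f = csum m f.
Proof.
  intros H H0; induction H as [|K H IH]; [reflexivity|].
  simpl; rewrite IH, H0 by lia; ring.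
Qed.

(** As [A_{m,k} = 0] for [k > m], the inner sum may run up to any common [K]; exchanging the sums
    then exhibits the Cauchy product [ccoef]. A single [K] can thus serve every [r]. *)
Lemma rho_ccoef K r v : (2 * r + 1 <= K)%nat ->
  rho r v = (RtoC (kdelta r)
    - csum K (fun k => RtoC ((-1) ^ k * INR (dfact (2 * (k + r))) / INR (fact k))
                       * ccoef v k (2 * r + 1)%nat))%C.
Proof.
  intros HK; unfold rho; f_equal.
  unfold ccoef, conv.
  transitivity (csum K (fun k => csum (2 * r + 1) (fun m =>
     (RtoC ((-1) ^ k * INR (dfact (2 * (k + r))) / INR (fact k))
      * (RtoC ((-1) ^ m * deMoivre aseq k m) * cbinom v (2 * r + 1 - m)))%C))).
  2:{ apply csum_ext; intros k _; now rewrite csum_scal. }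
  rewrite csum_exchange; apply csum_ext; intros m Hm.
  rewrite RtoC_sum, (csum_extend m K) by
    (try lia; intros k Hk; rewrite deMoivre_gt, Rmult_0_r by lia; ring).
  rewrite <- !csum_scal; apply csum_ext; intros k _.
  replace (2 * r + 2 * k)%nat with (2 * (k + r))%nat by lia.
  assert (E : (-1) ^ k * (-1) ^ k = 1).
  { rewrite <- Rpow_mult_distr; replace (-1 * -1) with 1 by ring; apply pow1. }
  replace (INR (dfact (2 * (k + r))) / ((-1) ^ k * INR (fact k)))
    with ((-1) ^ k * INR (dfact (2 * (k + r))) / INR (fact k)).
  - rewrite !RtoC_mult; ring.
  - pose proof (INR_fact_neq_0 k).
    assert ((-1) ^ k <> 0) by (apply pow_nonzero; lra).
    apply Rmult_eq_reg_l with ((-1) ^ k); [|assumption].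
    transitivity ((-1) ^ k * (-1) ^ k * INR (dfact (2 * (k + r))) / INR (fact k));
      [unfold Rdiv; ring|].
    rewrite E; field; split; assumption.
Qed.

Lemma csum_kdelta R' (n : R) :
  csum R' (fun r => RtoC (kdelta r) / RtoC (n ^ r))%C = RtoC 1.
Proof.
  rewrite (csum_extend 0 R').
  - simpl; unfold kdelta; simpl; field; injection; lra.
  - lia.
  - intros [|k] Hk; [lia|]; unfold kdelta; simpl Nat.eqb; cbv iota.
    unfold Cdiv; ring.
Qed.

(** The integral of the [(k, r)] term contributes [n^k / n^(k+r+1)], so after the factor [n/2] the
    power is [n^(-r)] whatever [k] is. Collecting by [r] gives [rho r], with [2^(k+r) (k+r)!] read
    as a double factorial. *)
Lemma wint_rho n v R' : 0 < n ->
  (RtoC 1 - RtoC (n / 2) * wint n v R')%C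
  = csum R' (fun r => rho r v / RtoC (n ^ r))%C.
Proof.
  intros Hn; unfold wint; rewrite csum_exchange, <- (csum_kdelta R' n), <- csum_scal.
  rewrite <- csum_minus.
  apply csum_ext; intros r Hr.
  rewrite (rho_ccoef (2 * R' + 2)) by lia.
  set (S1 := csum (2 * R' + 2) (fun k => wcoef n v k r * _)%C).
  set (S2 := csum (2 * R' + 2) _).
  assert (E : (RtoC (n / 2) * S1 = / RtoC (n ^ r) * S2)%C).
  { unfold S1, S2; rewrite <- !csum_scal; apply csum_ext; intros k _.
    unfold wcoef; rewrite dfact_even, mult_INR, pow_INR.
    assert (Hnr : n ^ r <> 0) by (apply pow_nonzero; lra).
    assert (Hnk : n ^ k <> 0) by (apply pow_nonzero; lra).
    pose proof (INR_fact_neq_0 k).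
    rewrite <- RtoC_inv by assumption.
    transitivity (RtoC (n / 2 * (2 * (- n) ^ k / INR (fact k))
       * (2 ^ (k + r) * INR (fact (k + r)) / n ^ S (k + r)))
       * ccoef v k (2 * r + 1)%nat)%C; [rewrite !RtoC_mult; ring|].
    transitivity (RtoC (/ n ^ r * ((-1) ^ k
       * (INR 2 ^ (k + r) * INR (fact (k + r))) / INR (fact k)))
       * ccoef v k (2 * r + 1)%nat)%C; [|rewrite !RtoC_mult; ring].
    do 2 f_equal.
    replace (- n) with (-1 * n) by ring.
    replace (INR 2) with 2 by (simpl; ring).
    rewrite Rpow_mult_distr, <- tech_pow_Rmult, (pow_add n).
    field; repeat split; try assumption; lra. }
  rewrite E; unfold Cdiv; ring.
Qed.

Theorem theorem4p2 (v : Cx) (R0 : nat) (HR : (1 <= R0)%nat) :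
  exists K : R, exists N : R,
    forall n : R, N <= n -> 0 < n -> -1 < Re (Cplus (RtoC n) v) ->
      Cmod (Cminus (theta n v)
              (csum (R0 - 1) (fun r => Cdiv (rho r v) (RtoC (n ^ r)))))
      <= K / n ^ R0.
Proof.
  destruct R0 as [|R']; [lia|]; clear HR.
  replace (S R' - 1)%nat with R' by lia.
  destruct (INR_unbounded (Rabs (Re v))) as [A HA].
  (* With [R = R' + 1], [S K] is the order [M = 2R + 1]. *)
  set (K := (2 * R' + 2)%nat).
  destruct (gfun_approx v A K (Rlt_le _ _ HA)) as (B & HB & Happ).
  exists (B * (2 ^ S R' * INR (fact (S R')) * 4 ^ S (S R')
               + INR (fact (A + K)) * 8 ^ S (A + K))).
  (* This threshold gives [n >= A] for the approximation, [Re (n + v) >= 1] for continuity at [-1],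
     and [n >= 1] for comparing powers of [n]. *)
  exists (INR A + 1); intros n HN Hn _.
  pose proof (pos_INR A) as HA0.
  assert (Hw : 1 <= Re (RtoC n + v)%C).
  { replace (Re (RtoC n + v)%C) with (n + Re v) by reflexivity.
    apply Rabs_def2 in HA; lra. }
  set (Lm := RInt (V := C_R_CompleteNormedModule) (gfun n v) (-1) 0).
  assert (HLm : is_RInt (V := C_R_NormedModule) (gfun n v) (-1) 0 Lm)
    by (apply is_RInt_gfun, Hw).
  pose proof (is_RInt_gen_gfun_opp n v Lm HLm) as Hopp.
  pose proof (is_RInt_gen_wfun n v R' Hn) as HW.
  set (err := fun s => (gfun n v s - gfun n v (- s)%R - wfun n v R' s)%C).
  (* The [2] accounts for the errors at [s] and [-s]; the rates are written with [n/4] and [n/8] to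
     fit the two integral formulas. *)
  set (G := fun s => 2 * B * (s ^ (2 * S R' + 1) * exp (- (n / 4 * s ^ 2 / 2))
                              + s ^ (A + K) * exp (- (n / 8 * s)))).
  set (lG := 2 * B * (2 ^ S R' * INR (fact (S R')) / (n / 4) ^ S (S R')
                      + INR (fact (A + K)) / (n / 8) ^ S (A + K))).
  assert (HG : is_RInt_gen G (at_point 0) (Rbar_locally p_infty) lG).
  { apply (is_RInt_gen_scal (V := R_NormedModule)
      (fun s => s ^ (2 * S R' + 1) * exp (- (n / 4 * s ^ 2 / 2))
                + s ^ (A + K) * exp (- (n / 8 * s))) (2 * B)).
    apply (is_RInt_gen_plus (V := R_NormedModule)
      (fun s => s ^ (2 * S R' + 1) * exp (- (n / 4 * s ^ 2 / 2)))
      (fun s => s ^ (A + K) * exp (- (n / 8 * s)))).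
    - apply is_RInt_gen_odd_gauss; lra.
    - apply is_RInt_gen_pow_exp; lra. }
  assert (Herr : forall s, 0 <= s -> norm (V := C_R_NormedModule) (err s) <= G s).
  { intros s Hs; rewrite norm_C_R.
    assert (E : err s =
      ((gfun n v s - RtoC (exp (- (n * s ^ 2 / 2))) * pfun n v K s)
       - (gfun n v (- s)%R
          - RtoC (exp (- (n * (- s) ^ 2 / 2))) * pfun n v K (- s)%R))%C).
    { unfold err; rewrite <- pfun_odd_part; fold K; ring. }
    rewrite E; unfold Cminus at 1.
    eapply Rle_trans; [apply Cmod_triangle|]; rewrite Cmod_opp.
    assert (HnA : INR A <= n) by lra.
    pose proof (Happ n s Hn HnA) as H1; pose proof (Happ n (- s) Hn HnA) as H2.
    rewrite Rabs_Ropp in H2; replace ((- s) ^ 2) with (s ^ 2) in H2 |- * by ring.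
    rewrite (Rabs_pos_eq s) in H1, H2 by assumption.
    unfold G; replace (2 * S R' + 1)%nat with (S K) by (unfold K; lia).
    replace (n / 4 * s ^ 2 / 2) with (n * s ^ 2 / 8) by field.
    replace (n / 8 * s) with (n * s / 8) by field.
    lra. }
  assert (Hcerr : forall s, ccontinuous err s).
  { intros s; unfold err, Cminus.
    apply ccontinuous_plus; [apply ccontinuous_plus|].
    - apply ccontinuous_gfun, Hw.
    - apply ccontinuous_opp.
      assert (Hl : ccontinuous (fun t => gfun n v (-1 * t + 0)) s)
        by (apply ccontinuous_lin, ccontinuous_gfun, Hw).
      destruct Hl as [L1 L2]; split;
        [revert L1|revert L2]; apply continuous_ext; intros t;
        do 2 f_equal; ring.
    - apply ccontinuous_opp, ccontinuous_wfun. }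
  destruct (ex_RInt_gen_dominated (V := C_R_CompleteNormedModule) err G lG)
    as [le Hle].
  { intros a b; apply (@ex_RInt_continuous C_R_CompleteNormedModule); intros s _.
    apply ccontinuous_continuous, Hcerr. }
  { intros a b; apply (@ex_RInt_continuous R_CompleteNormedModule); intros s _.
    apply (ex_derive_continuous G); unfold G; auto_derive; trivial. }
  { exact Herr. }
  { exact HG. }
  assert (Hnorm : Cmod le <= lG).
  { rewrite <- norm_C_R.
    apply (RInt_gen_norm (V := C_R_CompleteNormedModule)
      (Fa := at_point 0) (Fb := Rbar_locally p_infty) err G le lG).
    - apply Filter_prod with (fun x => x = 0) (fun b => 0 < b);
        [reflexivity|exists 0; auto|intros x b -> Hb; simpl; lra].
    - apply Filter_prod with (fun x => x = 0) (fun b => 0 < b);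
        [reflexivity|exists 0; auto|].
      intros x b -> Hb s Hs; apply Herr, Hs.
    - exact Hle.
    - exact HG. }
  (* Convergence on the right half-line is obtained by writing [g(s)] as error plus [g(-s)] plus odd
     part, each already integrable. *)
  assert (HLp : is_RInt_gen (V := C_R_NormedModule) (gfun n v) (at_point 0)
            (Rbar_locally p_infty) (le + Lm + wint n v R')%C).
  { apply (is_RInt_gen_ext (V := C_R_NormedModule))
      with (fun s => err s + gfun n v (- s)%R + wfun n v R' s)%C.
    - apply filter_forall; intros ab s _; unfold err; as_complex_eq; ring.
    - apply (is_RInt_gen_plus (V := C_R_NormedModule)
        (fun s => err s + gfun n v (- s)%R)%C (wfun n v R')); [|exact HW].
      apply (is_RInt_gen_plus (V := C_R_NormedModule) err
        (fun s => gfun n v (- s)%R)); [exact Hle|exact Hopp]. }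
  rewrite (theta_gfun n v Lm _ Hn Hw HLm HLp), <- (wint_rho n v R' Hn).
  (* [Lm] and the explicit integral cancel: the whole remainder is [-(n/2)] times the integral of
     the error. *)
  match goal with |- Cmod ?z <= _ =>
    replace z with (- (RtoC (n / 2) * le))%C by ring end.
  rewrite Cmod_opp, Cmod_mult, Cmod_R, Rabs_pos_eq by lra.
  apply Rle_trans with (n / 2 * lG).
  { apply Rmult_le_compat_l; [lra|exact Hnorm]. }
  assert (H4 : (n / 4) ^ S (S R') = n * n ^ S R' / 4 ^ S (S R')).
  { unfold Rdiv; rewrite Rpow_mult_distr, pow_inv; reflexivity. }
  assert (H8 : (n / 8) ^ S (A + K) = n * n ^ (A + K) / 8 ^ S (A + K)).
  { unfold Rdiv; rewrite Rpow_mult_distr, pow_inv; reflexivity. }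
  assert (Hn1 : 0 < n ^ S R') by (apply pow_lt, Hn).
  assert (Hn2 : 0 < n ^ (A + K)) by (apply pow_lt, Hn).
  assert (Hp4 : 0 < 4 ^ S (S R')) by (apply pow_lt; lra).
  assert (Hp8 : 0 < 8 ^ S (A + K)) by (apply pow_lt; lra).
  assert (Hle2 : / n ^ (A + K) <= / n ^ S R').
  { apply Rinv_le_contravar; [exact Hn1|apply Rle_pow; [lra|unfold K; lia]]. }
  unfold lG; rewrite H4, H8.
  set (c1 := 2 ^ S R' * INR (fact (S R'))) in *.
  set (c2 := INR (fact (A + K))) in *.
  replace (n / 2 * (2 * B * (c1 / (n * n ^ S R' / 4 ^ S (S R'))
             + c2 / (n * n ^ (A + K) / 8 ^ S (A + K)))))
    with (B * (c1 * 4 ^ S (S R') * / n ^ S R'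
               + c2 * 8 ^ S (A + K) * / n ^ (A + K)))
    by (field; repeat split; lra).
  replace (B * (c1 * 4 ^ S (S R') + c2 * 8 ^ S (A + K)) / n ^ S R')
    with (B * (c1 * 4 ^ S (S R') * / n ^ S R' + c2 * 8 ^ S (A + K) * / n ^ S R'))
    by (unfold Rdiv; ring).
  apply Rmult_le_compat_l; [exact HB|]; apply Rplus_le_compat_l.
  apply Rmult_le_compat_l; [|exact Hle2].
  apply Rmult_le_pos; [apply pos_INR|lra].
Qed.
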